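(* Let $A$ be a commutative ring, $r,d\ge1$, $B=A[x_1,\dots,x_r]$. Let $\mathcal{C}\subseteq\{1,\dots,d\}\times\mathcal{M}^*$ be one of the two collections $$\mathcal{C}_1=\{(k,x^\alpha):\gcd(\alpha)\cdot1_A\text{ invertible},\ k\text{ a product of primes in }\mathcal{P}(A)\},\qquad \mathcal{C}_2=\{(k,x^\alpha):\gcd(\alpha)=1\},$$ and let $\widetilde{\mathcal{C}}$ be the set of $(k,x^\alpha)\in\mathcal{C}$ such that either $k|\alpha|\le d$ or $Q_p(k\alpha)\le Q_p(d)$ for some $p\in\mathcal{P}(A)$. Then the $A$-algebra $\Gamma^d_A(B)\cong\mathrm{TS}^d_A(B)$ is generated by the elements $\gamma^k(x^\alpha)\times\gamma^{d-k}(1)$, $(k,x^\alpha)\in\widetilde{\mathcal{C}}$, and this is a minimal set of generators (no proper subset generates).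
   Context: $\mathrm{TS}^d_A(B)=(B^{\otimes_A d})^{\mathfrak S_d}$ is the ring of multisymmetric functions (symmetric tensors, componentwise multiplication), canonically isomorphic to the divided power algebra $\Gamma^d_A(B)$. $\mathcal{M}^*$ is the set of non-constant monomials $x^\alpha$, $\alpha\in\mathbb{N}^r\setminus\{0\}$; $|\alpha|=\sum\alpha_i$. $\mathcal{P}(A)$ is the set of primes $p$ with $p\cdot1_A$ not invertible in $A$ (a product of primes includes $k=1$). For a monomial $f$, $\gamma^k(f)\times\gamma^{d-k}(1)=\sum_{S\subseteq\{1..d\},|S|=k}\bigotimes_j f_j$ with $f_j=f$ for $j\in S$, $f_j=1$ otherwise. For $n\in\mathbb{N}$, $Q_p(n)\in\mathbb{Z}[t]$ is $a_st^s+\dots+a_0$ where $a_s\dots a_0$ are the base-$p$ digits of $n$; for $\beta\in\mathbb{N}^r$, $Q_p(\beta)=\sum_iQ_p(\beta_i)$. For $P,Q\in\mathbb{Z}[t]$, $P>Q$ means $P(n)>Q(n)$ for all sufficiently large $n$, and $P\le Q$ means not $P>Q$. *)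

(* Defs.v *)
From HB Require Import structures.
From mathcomp Require Import all_boot all_order all_algebra all_fingroup.
From mathcomp Require Import mpoly.
Set Implicit Arguments. Unset Strict Implicit. Unset Printing Implicit Defensive.
Import Order.TTheory GRing.Theory Num.Theory.
Local Open Scope ring_scope.

(* B^{(x)d} = A[x_1..x_r]^{(x)_A d} is identified with the polynomial ring
   A[x_{i,j} : i < r, j < d] in r*d variables; x_{i,j} = x_i in tensor slot j. *)
Definition var_idx (r d : nat) (i : 'I_r) (j : 'I_d) : 'I_(r * d) :=
  mxvec_index i j.

Definition pair_of (r d : nat) (k : 'I_(r * d)) : 'I_r * 'I_d :=
  enum_val (cast_ord (esym (mxvec_cast r d)) k).

Definition act (A : comNzRingType) (r d : nat) (s : 'S_d)
    (p : {mpoly A[r * d]}) : {mpoly A[r * d]} :=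
  comp_mpoly [tuple 'X_(var_idx (pair_of k).1 (s (pair_of k).2)) | k < r * d] p.

Definition TS (A : comNzRingType) (r d : nat) (p : {mpoly A[r * d]}) : Prop :=
  forall s : 'S_d, act s p = p.

Definition gam (A : comNzRingType) (r d k : nat) (a : 'X_{1..r}) : {mpoly A[r * d]} :=
  \sum_(S : {set 'I_d} | #|S| == k)
     \prod_(j in S) \prod_(i < r) 'X_(var_idx i j) ^+ (a i).

Inductive gen_alg (A : comNzRingType) (n : nat) (G : {mpoly A[n]} -> Prop)
  : {mpoly A[n]} -> Prop :=
| ga_gen g : G g -> gen_alg G g
| ga_const (c : A) : gen_alg G c%:MP
| ga_add p q : gen_alg G p -> gen_alg G q -> gen_alg G (p + q)
| ga_mul p q : gen_alg G p -> gen_alg G q -> gen_alg G (p * q).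

Definition invertible (A : comNzRingType) (x : A) : Prop := exists y : A, x * y = 1.

Definition inP (A : comNzRingType) (p : nat) : Prop :=
  prime p /\ ~ invertible (p%:R : A).

Definition prod_of_P (A : comNzRingType) (k : nat) : Prop :=
  exists s : seq nat, (forall p, p \in s -> inP A p) /\ k = (\prod_(p <- s) p)%N.

Definition mgcd (r : nat) (a : 'X_{1..r}) : nat := (\big[gcdn/0%N]_(i < r) a i)%N.

(* Q_p(n) = sum of base-p digits times t^i (n < p^(n+1), so n.+1 digits suffice) *)
Definition Qp (p n : nat) : {poly int} :=
  \sum_(i < n.+1) ((n %/ p ^ i) %% p)%N%:R *: 'X^i.

Definition Qpv (r p k : nat) (a : 'X_{1..r}) : {poly int} :=
  \sum_(i < r) Qp p (k * a i)%N.

Definition polygt (P Q : {poly int}) : Prop :=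
  exists N : nat, forall n : nat, (N <= n)%N -> Q.[n%:Z] < P.[n%:Z].
Definition polyle (P Q : {poly int}) : Prop := ~ polygt P Q.

Definition inC (A : comNzRingType) (r d : nat) (c : bool) (k : nat) (a : 'X_{1..r}) : Prop :=
  [/\ (1 <= k <= d)%N, a != 0%MM &
      if c then invertible ((mgcd a)%:R : A) /\ prod_of_P A k
      else mgcd a = 1%N].

Definition inCt (A : comNzRingType) (r d : nat) (c : bool) (k : nat) (a : 'X_{1..r}) : Prop :=
  inC A d c k a /\
  ((k * mdeg a <= d)%N \/ exists p, inP A p /\ polyle (Qpv p k a) (Qp p d)).

(* Main.v *)
Require Import Defs.
From HB Require Import structures.
From mathcomp Require Import all_boot all_order all_algebra all_fingroup.
From mathcomp Require Import mpoly.
From mathcomp Require Import zify.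
From Stdlib Require Import Classical_Prop.
Set Implicit Arguments. Unset Strict Implicit. Unset Printing Implicit Defensive.
Import Order.TTheory GRing.Theory Num.Theory.
Local Open Scope ring_scope.

(** The ring TS^n is spanned by orbit sums of monomials, and modulo products of
    elements of lower degree the component of multidegree b is generated by the
    single element gamma^g(x^(b/g)), where g = gcd(b): an orbit sum with two
    distinct nonzero exponent vectors is, up to products, a combination of orbit
    sums with fewer nonzero slots, and powers of one monomial are handled by the
    fundamental theorem of symmetric polynomials.

    To see which multiples of this generator are decomposable, fix a prime p and
    work with n = p^K >= d slots, K large.  Restriction to the diagonal sends
    elements of TS^n without constant term to multiples of p in low degrees, so
    the derivation f |-> (x_(i0,j0) df/dx_(i0,j0)) restricted to the diagonal
    kills products modulo p.  On an orbit sum its value times n is b_(i0) times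
    the number of monomials, a multinomial coefficient, and Legendre's formula
    shows that it vanishes modulo p on all orbit sums with more than d nonzero
    slots (the kernel of TS^n -> TS^d) exactly when Q_p(b) <= Q_p(d).  Over Z this
    gives, for every p in P(A) with Q_p(b) > Q_p(d), a decomposable multiple of
    the generator by an integer prime to p; over A it gives minimality.  If every
    prime is invertible in A, minimality comes instead from evaluating on the
    first i <= d slots: the value is a polynomial in i, and its linear coefficient
    is a derivation at i = 0. *)

(** * Base-p digits and Legendre's formula *)

Section Digits.
Local Open Scope nat_scope.

Definition dig (p x k : nat) : nat := x %/ p ^ k %% p.

(** The value at [n] of the digit polynomial of [x]; digits from place [x] on vanish, so the width
    [x.+1] is only a convenient bound. *)
Definition qv (p n x : nat) : nat := \sum_(k < x.+1) dig p x k * n ^ k.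

Lemma dig_eq0 p x k : 1 < p -> x <= k -> dig p x k = 0.
Proof.
move=> p1 xk; rewrite /dig divn_small ?mod0n //.
by apply: leq_ltn_trans xk (ltn_expl _ p1).
Qed.

Lemma qv_wide p n x L : 1 < p -> x < L ->
  \sum_(k < L) dig p x k * n ^ k = qv p n x.
Proof.
move=> p1 xL; rewrite /qv -[LHS](big_mkord xpredT (fun k => dig p x k * n ^ k)).
rewrite (big_cat_nat (n := x.+1)) //= big_mkord [X in _ + X]big_nat_cond.
rewrite [X in _ + X]big1 ?addn0 // => k /andP[/andP[/ltnW xk _] _].
by rewrite dig_eq0.
Qed.

Lemma dig0 p x : dig p x 0 = x %% p.
Proof. by rewrite /dig expn0 divn1. Qed.

Lemma digS p x k : dig p x k.+1 = dig p (x %/ p) k.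
Proof. by rewrite /dig expnS divnMA. Qed.

Lemma qv_rec p n x : 1 < p -> qv p n x = x %% p + n * qv p n (x %/ p).
Proof.
move=> p1; rewrite -(@qv_wide p n x x.+2) // big_ord_recl /= muln1 dig0.
congr (_ + _); rewrite -(@qv_wide p n (x %/ p) x.+1) //; last first.
  by rewrite ltnS leq_div.
rewrite big_distrr /=; apply: eq_bigr => k _.
by rewrite /bump /= add1n digS expnS mulnCA.
Qed.

Lemma qv0 p n : qv p n 0 = 0.
Proof. by rewrite /qv big_ord1 dig0 mod0n. Qed.

Lemma qv1 p n : 1 < p -> qv p n 1 = 1.
Proof. by move=> p1; rewrite qv_rec // divn_small // modn_small // qv0 muln0. Qed.

(** A carry trades [p] units at one place for one unit at the next place, which weighs [n >= p]
    times as much. *)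
Lemma qv_add p n a b : 1 < p -> p <= n -> qv p n a + qv p n b <= qv p n (a + b).
Proof.
move=> p1 pn; have [m] := ubnP (a + b); elim: m a b => // m IH a b ltm.
have [ab0|abp] := posnP (a + b).
  by move/eqP: ab0; rewrite addn_eq0 => /andP[/eqP-> /eqP->]; rewrite qv0.
rewrite (qv_rec n a p1) (qv_rec n b p1) (qv_rec n (a + b) p1).
have p0 : 0 < p by apply: ltnW.
rewrite divnD // modnD //.
set c := (p <= _ + _).
have lt1 : a %/ p + b %/ p + c < m.
  have : a %/ p + b %/ p + c = (a + b) %/ p by rewrite divnD.
  by move=> ->; apply: leq_trans (ltn_Pdiv p1 abp) _.
have IH1 : qv p n (a %/ p + b %/ p) + qv p n c <= qv p n (a %/ p + b %/ p + c).
  by apply: IH.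
have IH2 : qv p n (a %/ p) + qv p n (b %/ p) <= qv p n (a %/ p + b %/ p).
  by apply: IH; lia.
have qc : qv p n c = c by case: (c); rewrite ?qv0 ?qv1.
rewrite qc in IH1.
have : n * (qv p n (a %/ p) + qv p n (b %/ p) + c)
       <= n * qv p n (a %/ p + b %/ p + c).
  by rewrite leq_mul2l; apply/orP; right; lia.
have : p * c <= n * c by rewrite leq_mul2r pn orbT.
have : p * c <= a %% p + b %% p.
  by rewrite /c; case: (leqP p (a %% p + b %% p)) => h; rewrite /= ?muln0 ?muln1.
rewrite !mulnDr; lia.
Qed.

Lemma qv_mono p n a b : 1 < p -> p <= n -> a <= b -> qv p n a <= qv p n b.
Proof.
move=> p1 pn /subnKC <-; apply: leq_trans (qv_add _ _ _ _) => //.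
exact: leq_addr.
Qed.

Lemma qv_ltS p n a : 1 < p -> p <= n -> qv p n a < qv p n a.+1.
Proof.
by move=> p1 pn; rewrite -addn1 -[a.+1]addn1 -{1}(qv1 n p1); apply: qv_add.
Qed.

Lemma qv_sum p n (I : Type) (u : seq I) (P : pred I) F : 1 < p -> p <= n ->
  \sum_(i <- u | P i) qv p n (F i) <= qv p n (\sum_(i <- u | P i) F i).
Proof.
move=> p1 pn; elim/big_rec2: _ => [|i x y _ le]; first by rewrite qv0.
by apply: leq_trans (qv_add _ _ _ _) => //; rewrite leq_add2l.
Qed.

(** Legendre's formula with a number of terms independent of [x], so that factorials of different
    numbers can be compared level by level. *)
Lemma logn_fact_le p K x : prime p -> x < p ^ K.+1 ->
  logn p x`! = \sum_(1 <= k < K.+1) x %/ p ^ k.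
Proof.
move=> pp xK; rewrite logn_fact //.
have E M N : M <= N -> (forall k, M <= k -> x %/ p ^ k = 0) ->
   \sum_(1 <= k < N) x %/ p ^ k = \sum_(1 <= k < M) x %/ p ^ k.
  move=> MN z; case: M MN z => [_ z|M MN z].
    by rewrite [RHS]big_geq // big1 // => k _; apply: z.
  rewrite (big_cat_nat (n := M.+1)) //= [X in _ + X]big_nat_cond.
  by rewrite [X in _ + X]big1 ?addn0 // => k /andP[/andP[? _] _]; apply: z.
have z1 k : x.+1 <= k -> x %/ p ^ k = 0.
  move=> xk; apply: divn_small; apply: leq_trans xk (ltnW (ltn_expl _ _)).
  exact: prime_gt1.
have z2 k : K.+1 <= k -> x %/ p ^ k = 0.
  move=> Kk; apply: divn_small; apply: leq_trans xK _.
  by rewrite leq_exp2l // prime_gt1.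
have [le|lt] := leqP K x; first by rewrite (E K.+1).
by rewrite [RHS](E x.+1) // ltnS ltnW.
Qed.

Lemma logn_prod p (I : eqType) (u : seq I) F : (forall i, i \in u -> 0 < F i) ->
  logn p (\prod_(i <- u) F i) = \sum_(i <- u) logn p (F i).
Proof.
elim: u => [|i u IH] Fp; first by rewrite !big_nil logn1.
rewrite !big_cons lognM ?Fp ?mem_head //; last first.
  rewrite big_seq; apply: prodn_cond_gt0 => j ju; apply: Fp.
  by rewrite in_cons ju orbT.
by rewrite IH // => j ju; apply: Fp; rewrite in_cons ju orbT.
Qed.

Lemma sum_divn_le (I : Type) (u : seq I) F q : 
  \sum_(i <- u) F i %/ q <= (\sum_(i <- u) F i) %/ q.
Proof.
elim/big_rec2: _ => [|i x y _ le]; first by rewrite div0n.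
case: q le => [|q] le; first by rewrite !divn0 in le *.
by rewrite divnD // -addnA leq_add2l (leq_trans le) // leq_addr.
Qed.

(* No carries occur, so the digits add up. *)
Lemma qv_sum_eq p n (I : Type) (u : seq I) F M : 1 < p ->
  (forall k, \sum_(i <- u) F i %/ p ^ k = M %/ p ^ k) ->
  \sum_(i <- u) qv p n (F i) = qv p n M.
Proof.
move=> p1 H.
have HM : \sum_(i <- u) F i = M.
  have := H 0; rewrite expn0 divn1 => <-; apply: eq_bigr => i _.
  by rewrite divn1.
(* A digit is [x %/ p ^ k] minus [p] times [x %/ p ^ k.+1]. Both quotients are additive over [u] by
   hypothesis, hence so is the digit sum [q], which is written with a common width [M.+1]. *)
pose g x := \sum_(k < M.+1) (x %/ p ^ k) * n ^ k.
pose h x := \sum_(k < M.+1) (p * (x %/ p ^ k.+1)) * n ^ k.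
pose q x := \sum_(k < M.+1) dig p x k * n ^ k.
have ghq x : g x = h x + q x.
  rewrite -big_split /=; apply: eq_bigr => k _; rewrite -mulnDl /dig.
  by rewrite expnSr divnMA [p * _]mulnC -divn_eq.
have gs : \sum_(i <- u) g (F i) = g M.
  rewrite exchange_big /=; apply: eq_bigr => k _.
  by rewrite -big_distrl /= H.
have hs : \sum_(i <- u) h (F i) = h M.
  rewrite exchange_big /=; apply: eq_bigr => k _.
  by rewrite -big_distrl -big_distrr /= H.
have qs : \sum_(i <- u) q (F i) = q M.
  have := gs; rewrite ghq (eq_bigr _ (fun i _ => ghq (F i))) big_split /= hs.
  by move/addnI.
rewrite -(@qv_wide _ n M M.+1) // -/(q M) -qs.
have : forall x, x <= M -> qv p n x = q x.
  by move=> x xM; rewrite -(@qv_wide _ n x M.+1).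
move=> qE; move: HM; clear -qE.
elim: u => [|i u IH] in M q qE *; first by rewrite !big_nil.
rewrite !big_cons => HM; congr (_ + _); first by apply: qE; lia.
have : forall x, x <= \sum_(j <- u) F j -> qv p n x = q x.
  by move=> x xM; apply: qE; lia.
elim: u {IH HM} => [|j u IH] H; first by rewrite !big_nil.
move: H; rewrite !big_cons => H.
congr (_ + _); first by apply: H; lia.
by apply: IH => x xM; apply: H; lia.
Qed.

Section Multinomial.
(** Abstract data of an orbit sum in [p ^ K] slots: [m v] is the multiplicity of the exponent vector
    [v], [w v] its coordinate at a fixed index, [c] the number of monomials, [b] the total
    coordinate and [t] the value of the diagonal functional. *)
Variables (p K : nat) (I : eqType) (u : seq I) (m w : I -> nat) (c b t : nat).
Hypothesis pp : prime p.
Hypothesis uu : uniq u.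
Hypothesis sm : \sum_(v <- u) m v = p ^ K.
Hypothesis cE : c * \prod_(v <- u) (m v)`! = (p ^ K)`!.
Hypothesis bE : b = \sum_(v <- u) m v * w v.
Hypothesis b0 : 0 < b.
Hypothesis ctE : p ^ K * t = b * c.

Let p1 : 1 < p := prime_gt1 pp.

Lemma mult_gt0 : 0 < c.
Proof. by case: c cE => // /esym/eqP; rewrite mul0n -leqn0 leqNgt fact_gt0. Qed.

Lemma mult_t_gt0 : 0 < t.
Proof.
case: t ctE => // /esym/eqP; rewrite muln0 muln_eq0.
by rewrite !eqn0Ngt b0 mult_gt0.
Qed.

Lemma mult_logn : K + logn p t = logn p b + logn p c.
Proof.
have := congr1 (logn p) ctE.
rewrite !lognM ?mult_gt0 ?mult_t_gt0 ?expn_gt0 ?(prime_gt0 pp) //.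
by rewrite pfactorK.
Qed.

(** If [p] does not divide [t], removing one copy of a suitable vector [v0] leaves a multinomial
    coefficient prime to [p], so the reduced multiplicities add up to [p ^ K - 1] without carries.
    Superadditivity then bounds the value for [d], and restoring the copy makes the bound strict. *)
Lemma mult_qv_gt z d n : z \in u -> w z = 0 -> ~~ (p %| t) -> p <= n ->
  d < \sum_(v <- u | v != z) m v ->
  qv p n d < \sum_(v <- u | v != z) qv p n (m v).
Proof.
move=> zu wz pt pn dl.
have lt0 : logn p t = 0.
  by apply/eqP; rewrite -leqn0 leqNgt -pfactor_dvdn ?mult_t_gt0 // expn1.
have lc := mult_logn; rewrite lt0 addn0 in lc.
(* Otherwise [p ^ (logn p b).+1] would divide every term of the sum [b]. *)
have [v0 v0u /and3P[wv0 mv0 lv0]] :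
    exists2 v0, v0 \in u & [&& w v0 != 0, 0 < m v0 & logn p (m v0) <= logn p b].
  apply/hasP; apply: contraT; rewrite -all_predC => /allP H.
  have : p ^ (logn p b).+1 %| b.
    rewrite {2}bE big_seq; apply: dvdn_sum => v vu.
    have /= := H _ vu; rewrite !negb_and negbK -leqNgt leqn0 -ltnNge.
    case/or3P => [/eqP->|/eqP->|lv]; rewrite ?muln0 ?mul0n ?dvdn0 //.
    have [->|mv] := posnP (m v); first by rewrite mul0n dvdn0.
    by apply: dvdn_mulr; rewrite pfactor_dvdn.
  by rewrite pfactor_dvdn // ltnn.
have v0z : v0 != z by apply: contraNneq wv0 => ->; rewrite wz.
pose m' v := m v - (v == v0).
have mm' v : m v = m' v + (v == v0).
  by rewrite /m'; case: eqP => [->|_]; rewrite ?subn0 ?addn0 // subnK.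
have sm' : \sum_(v <- u) m' v = (p ^ K).-1.
  move: sm; rewrite (eq_bigr _ (fun v _ => mm' v)) big_split /=.
  rewrite -big_mkcond /= -(big_filter _ (pred1 v0)) sum1_size.
  have -> : size [seq v <- u | v == v0] = 1.
    by rewrite size_filter count_uniq_mem // v0u.
  by rewrite addn1 => <-.
(* The reduced multinomial coefficient is [c * m v0 / p ^ K]; by [lc] and the choice of [v0] its
   valuation is not positive. *)
have fE : c * m v0 * \prod_(v <- u) (m' v)`! = p ^ K * (p ^ K).-1`!.
  have -> : p ^ K * (p ^ K).-1`! = (p ^ K)`!.
    by rewrite -{1 3}(@prednK (p ^ K)) ?expn_gt0 ?prime_gt0 // factS.
  rewrite -cE -mulnA; congr (_ * _).
  rewrite !(bigD1_seq v0) //= mulnA; congr (_ * _).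
    by rewrite mm' eqxx addn1 factS.
  by apply: eq_bigr => v vv0; rewrite mm' (negbTE vv0) addn0.
have m'gt : 0 < \prod_(v <- u) (m' v)`! by apply: prodn_gt0 => v; apply: fact_gt0.
have pK0 : 0 < p ^ K by rewrite expn_gt0 prime_gt0.
have lge : logn p (p ^ K).-1`! <= \sum_(v <- u) logn p (m' v)`!.
  have := congr1 (logn p) fE.
  rewrite !lognM ?muln_gt0 ?mult_gt0 ?fact_gt0 //.
  rewrite logn_prod; last by move=> *; apply: fact_gt0.
  rewrite pfactorK //; lia.
have ltK x : x <= (p ^ K).-1 -> x < p ^ K.+1.
  by move=> xK; apply: leq_ltn_trans xK _; rewrite prednK // leq_exp2l.
have m'le v : v \in u -> m' v <= (p ^ K).-1.
  by move=> vu; rewrite -sm' (bigD1_seq v) //= leq_addr.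
(* Every level satisfies one inequality, and the totals satisfy the opposite one, so equality holds
   at every level. *)
have Ek k : 1 <= k < K.+1 -> \sum_(v <- u) m' v %/ p ^ k = (p ^ K).-1 %/ p ^ k.
  have le k' : \sum_(v <- u) m' v %/ p ^ k' <= (p ^ K).-1 %/ p ^ k'.
    by rewrite -sm'; apply: sum_divn_le.
  move: lge; rewrite (logn_fact_le (K := K)) ?ltK //.
  rewrite (eq_big_seq (fun v => \sum_(1 <= k0 < K.+1) m' v %/ p ^ k0)); last first.
    by move=> v vu; rewrite (logn_fact_le (K := K)) // ltK // m'le.
  rewrite exchange_big /= => lge kr; apply/eqP; rewrite eqn_leq le /=.
  move: lge; rewrite !(bigD1_seq k) ?mem_index_iota ?iota_uniq //=.
  have : \sum_(1 <= i < K.+1 | i != k) \sum_(v <- u) m' v %/ p ^ i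
       <= \sum_(1 <= i < K.+1 | i != k) (p ^ K).-1 %/ p ^ i.
    by apply: leq_sum => i _; apply: le.
  by lia.
have Eall k : \sum_(v <- u) m' v %/ p ^ k = (p ^ K).-1 %/ p ^ k.
  have [k0|kpos] := posnP k.
    by rewrite k0 expn0 divn1 -sm'; apply: eq_bigr => v _; rewrite divn1.
  have [kK|Kk] := leqP k K; first by apply: Ek; rewrite kpos.
  have lk : (p ^ K).-1 < p ^ k.
    by rewrite prednK // leq_exp2l // ltnW.
  rewrite (divn_small lk) big_seq big1 // => v vu; apply: divn_small.
  by apply: leq_ltn_trans (m'le _ vu) lk.
have qE := qv_sum_eq n p1 Eall.
have m'z : m' z = m z by rewrite /m' eq_sym (negbTE v0z) subn0.
have D1 (F : I -> nat) : \sum_(v <- u | v != z) F v =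
     F v0 + \sum_(v <- u | (v != z) && (v != v0)) F v.
  rewrite (bigID (pred1 v0)) /= -big_filter; congr (_ + _).
  rewrite (eq_filter (a2 := pred1 v0)) ?filter_pred1_uniq ?big_seq1 // => v /=.
  by case: (v =P v0) => [->|]; rewrite ?andbF // v0z.
have m'E F : \sum_(v <- u | (v != z) && (v != v0)) F (m' v) =
    \sum_(v <- u | (v != z) && (v != v0)) F (m v) :> nat.
  by apply: eq_bigr => v /andP[_ vv0]; rewrite mm' (negbTE vv0) addn0.
have rest : d <= \sum_(v <- u | v != z) m' v.
  move: dl; rewrite !D1 (m'E id) mm' eqxx addn1 addSn ltnS; exact.
(* The carry-free identity is compared with superadditivity for the two summands [m' z] and the
   rest; the contribution of [z] cancels. *)
have le1 : qv p n d <= \sum_(v <- u | v != z) qv p n (m' v).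
  have := qE; rewrite -sm' [X in _ = qv p n X -> _](bigD1_seq z) //=.
  rewrite [X in X = _ -> _](bigD1_seq z) //=.
  have := qv_add (m' z) (\sum_(i <- u | i != z) m' i) p1 pn.
  have := qv_mono p1 pn rest; lia.
apply: leq_ltn_trans le1 _.
rewrite !D1 (m'E (qv p n)) ltn_add2r mm' eqxx addn1.
exact: qv_ltS.
Qed.

(** Level [k] of Legendre's formula contributes nothing to [logn p c] if [k <= logn p b] and at most
    one otherwise. Hence [logn p c <= K - logn p b], and [mult_logn] leaves no factor [p] in [t]. *)
Lemma mult_ndvd z : z \in u -> (forall v, v \in u -> p ^ logn p b %| m v) ->
  (forall k, logn p b < k <= K -> \sum_(v <- u | v != z) m v %% p ^ k <= p ^ k) ->
  ~~ (p %| t).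
Proof.
move=> zu dv le.
have pK0 k : 0 < p ^ k by rewrite expn_gt0 prime_gt0.
have ml v : v \in u -> m v <= p ^ K.
  by move=> vu; rewrite -sm (bigD1_seq v) //= leq_addr.
have ltK x : x <= p ^ K -> x < p ^ K.+1.
  by move=> xK; apply: leq_ltn_trans xK _; rewrite ltn_exp2l.
have sK : logn p b <= K.
  have [v vu mv] : exists2 v, v \in u & 0 < m v.
    apply/hasP; apply: contraT; rewrite -all_predC => /allP H.
    have : p ^ K = 0.
      rewrite -sm big_seq big1 // => v vu.
      by have := H _ vu; rewrite /= -leqNgt leqn0 => /eqP.
    by have := pK0 K; case: (p ^ K).
  have := dvdn_leq mv (dv _ vu).
  by move/leq_trans => /(_ _ (ml _ vu)); rewrite leq_exp2l.
have diff k : 1 <= k < K.+1 ->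
    p ^ K %/ p ^ k <= \sum_(v <- u) m v %/ p ^ k + (logn p b < k).
  move=> /andP[k0 kK].
  rewrite -(leq_pmul2r (pK0 k)) divnK ?dvdn_exp2l // mulnDl.
  rewrite big_distrl /= -{1}sm.
  rewrite (eq_bigr _ (fun v _ => divn_eq (m v) (p ^ k))) big_split /= leq_add2l.
  case: ltnP => [sk|ks]; last first.
    rewrite mul0n leqn0 big_seq big1 // => v vu; apply/eqP.
    by apply: dvdn_trans (dv _ vu); apply: dvdn_exp2l.
  rewrite mul1n.
  (* The remainder of [z] is less than [p ^ k] and the others add up to at most [p ^ k]. As the
     total is a multiple of [p ^ k], it is [0] or [p ^ k]. *)
  have lt2 : \sum_(v <- u) m v %% p ^ k < p ^ k * 2.
    rewrite (bigD1_seq z) //= muln2 -addnn -addSn leq_add ?ltn_pmod //.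
    by apply: le; rewrite sk.
  have : p ^ k %| \sum_(v <- u) m v %% p ^ k.
    have : p ^ k %| p ^ K by rewrite dvdn_exp2l.
    rewrite -sm (eq_bigr _ (fun v _ => divn_eq (m v) (p ^ k))) big_split /=.
    by rewrite -big_distrl /= dvdn_addr // dvdn_mull.
  case/dvdnP => q qE; move: lt2; rewrite qE mulnC ltn_pmul2l //.
  case: q qE => [|[|q]] //; rewrite ?muln0 ?muln1 //.
have lc : logn p c <= K - logn p b.
  have := congr1 (logn p) cE; rewrite lognM ?mult_gt0 //; last first.
    by apply: prodn_gt0 => v; apply: fact_gt0.
  rewrite logn_prod; last by move=> *; apply: fact_gt0.
  rewrite (logn_fact_le (K := K)) ?ltK //.
  rewrite (eq_big_seq (fun v => \sum_(1 <= k0 < K.+1) m v %/ p ^ k0)); last first.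
    by move=> v vu; rewrite (logn_fact_le (K := K)) // ltK // ml.
  rewrite exchange_big /=.
  have : \sum_(1 <= k < K.+1) p ^ K %/ p ^ k <=
     \sum_(1 <= k < K.+1) (\sum_(v <- u) m v %/ p ^ k + (logn p b < k)).
    by rewrite big_nat_cond [X in _ <= X]big_nat_cond; apply: leq_sum => k /andP[? _];
       apply: diff.
  rewrite big_split /=.
  have -> : \sum_(1 <= k < K.+1) (logn p b < k) = K - logn p b.
    rewrite (big_cat_nat (n := (logn p b).+1)) //= ?ltnS //.
    rewrite [X in X + _]big_nat_cond big1; last first.
      by move=> k /andP[/andP[_]]; rewrite ltnS leqNgt => /negbTE ->.
    rewrite big_nat_cond (eq_bigr (fun _ => 1)); last first.
      by move=> k /andP[/andP[-> _] _].
    by rewrite -big_nat_cond sum_nat_const_nat muln1 add0n subSS.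
  lia.
have := mult_logn => E; apply/negP => pt.
have : 0 < logn p t by rewrite -pfactor_dvdn ?mult_t_gt0 ?expn1.
lia.
Qed.

End Multinomial.
End Digits.

Lemma horner_Qp p n x : (Qp p x).[n%:Z] = (qv p n x)%:Z.
Proof.
rewrite /Qp horner_sum /qv -[RHS]natz natr_sum.
by apply: eq_bigr => k _; rewrite hornerZ hornerXn natrM natrX !natz.
Qed.

Lemma horner_Qpv p n r k (a : 'X_{1..r}) :
  (Qpv p k a).[n%:Z] = (\sum_(i < r) qv p n (k * a i))%N%:Z.
Proof.
rewrite /Qpv horner_sum -[RHS]natz natr_sum.
by apply: eq_bigr => i _; rewrite horner_Qp natz.
Qed.

(** * Comparison of digit polynomials place by place *)

Section DigitComparison.
Local Open Scope nat_scope.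

Lemma polygt_qvP p d r k (a : 'X_{1..r}) :
  polygt (Qpv p k a) (Qp p d) <->
  exists N, forall n, N <= n -> qv p n d < \sum_(i < r) qv p n (k * a i).
Proof.
by split=> -[N H]; exists N => n /H; rewrite horner_Qp horner_Qpv ltz_nat.
Qed.

(** Digits [C] below the base contribute less than [n ^ L] under place [L], so the first difference
    from the top decides the comparison. *)
Lemma lex_digits n L (C D : nat -> nat) : (forall k, k < L -> C k < n) ->
  \sum_(k < L) D k * n ^ k < \sum_(k < L) C k * n ^ k ->
  exists J, [/\ J < L, D J < C J & forall k, J < k < L -> C k = D k].
Proof.
elim: L => [|L IH] Cn; first by rewrite !big_ord0.
have lt : \sum_(k < L) C k * n ^ k < n ^ L.
  elim: L Cn {IH} => [|L IH] Cn; first by rewrite big_ord0.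
  rewrite big_ord_recr /= expnS.
  have := IH (fun k kL => Cn k (ltnW kL)).
  have : C L * n ^ L + n ^ L <= n * n ^ L.
    by rewrite -mulSnr leq_mul2r Cn ?orbT.
  by move: (n ^ L) (\sum_(k < L) _) => q c; lia.
rewrite !big_ord_recr /=; move: lt; set q := n ^ L; set s1 := \sum_(k < L) C _ * _.
set s2 := \sum_(k < L) D _ * _ => lt.
have [ltDC|ltCD|eqCD] := ltngtP (D L) (C L).
- by exists L; split=> // k /andP[a b]; move: (leq_trans a b); lia.
- have : C L * q + q <= D L * q by rewrite -mulSnr leq_mul2r ltCD orbT.
  by move: q s1 s2 lt => q s1 s2 lt; lia.
- rewrite eqCD ltn_add2r => /IH[|J [JL DJ H]]; first by move=> k kL; apply/Cn/ltnW.
  exists J; split=> // [|k]; first by apply: ltnW.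
  rewrite ltnS [k <= L]leq_eqVlt => /andP[Jk /orP[/eqP->|kL]] //.
  by apply: H; rewrite Jk.
Qed.

Lemma partial_sum r (x : 'I_r -> nat) t : t < \sum_i x i ->
  exists (n : 'I_r -> nat) (j : 'I_r),
    [/\ forall i, n i <= x i, \sum_i n i = t & n j < x j].
Proof.
have ex (n : 'I_r -> nat) : (forall i, n i <= x i) -> \sum_i n i < \sum_i x i ->
    exists j, n j < x j.
  move=> nx lt; case: (pickP (fun j => n j < x j)) => [j|] H; first by exists j.
  by move: lt; rewrite ltnNge leq_sum // => i _; rewrite leqNgt H.
elim: t => [|t IH] lt.
  have [//||j jl] := ex (fun _ => 0); first by rewrite sum_nat_const muln0.
  by exists (fun _ => 0), j; split; rewrite ?sum_nat_const ?muln0.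
have [n [j [nx sn nj]]] := IH (ltnW lt).
pose n' i := n i + (i == j).
have nx' i : n' i <= x i.
  by rewrite /n'; case: eqP => [->|_]; rewrite ?addn0 // addn1.
have sn' : \sum_i n' i = t.+1.
  by rewrite big_split /= sn -big_mkcond /= big_pred1_eq addn1.
have [|j' lt'] := ex n' nx'; first by rewrite sn'.
by exists n', j'.
Qed.

Lemma modn_pow_rec p x k : 0 < p -> x %% p ^ k.+1 = x %% p ^ k + dig p x k * p ^ k.
Proof.
move=> p0; have q0 : 0 < p ^ k by rewrite expn_gt0 p0.
rewrite /dig; have lw : x %% p ^ k < p ^ k by rewrite ltn_pmod.
have lv : x %/ p ^ k %% p < p by rewrite ltn_pmod.
have E : x = x %/ p ^ k %/ p * p ^ k.+1 + (x %% p ^ k + x %/ p ^ k %% p * p ^ k).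
  rewrite {1}(divn_eq x (p ^ k)) {1}(divn_eq (x %/ p ^ k) p) mulnDl expnS mulnA.
  by rewrite -addnA [_ + x %% _]addnC.
rewrite {1}E modnMDl; apply: modn_small; rewrite expnS.
move: lw lv; move: (p ^ k) (x %% p ^ k) (x %/ p ^ k %% p) => q w v lw lv.
have : v.+1 * q <= p * q by rewrite leq_mul2r lv orbT.
by apply: leq_trans; rewrite mulSn -addSn leq_add2r.
Qed.

Lemma sum_modn_pow p r (x : 'I_r -> nat) y : 1 < p ->
  (forall k, \sum_i dig p (x i) k = dig p y k) ->
  forall k, \sum_i x i %% p ^ k = y %% p ^ k.
Proof.
move=> p1 H; elim=> [|k IH].
  by rewrite expn0 modn1 big1 // => i _; rewrite modn1.
rewrite modn_pow_rec ?(ltnW p1) // -IH -H big_distrl -big_split /=.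
by apply: eq_bigr => i _; rewrite modn_pow_rec ?(ltnW p1).
Qed.

(** Above place [J] the digits of the [b i] add up to those of [d] without carry. At place [J] only
    as many units are taken as [d] has, so the [B i] sum to [d] rounded down to a multiple of
    [p ^ J], and some [b j] keeps a spare unit [p ^ J]. *)
Lemma digit_split p r (b : 'I_r -> nat) d J : 1 < p ->
  dig p d J < \sum_i dig p (b i) J ->
  (forall k, J < k -> \sum_i dig p (b i) k = dig p d k) ->
  exists (B : 'I_r -> nat) (j : 'I_r),
    [/\ forall i, B i + (i == j) * p ^ J <= b i, forall i, p ^ J %| B i,
        d < \sum_i B i + p ^ J &
        forall k, J < k -> \sum_i B i %% p ^ k + p ^ J <= p ^ k].
Proof.
move=> p1 dJ dk; have p0 : 0 < p by apply: ltnW.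
have [n [j [nb sn nj]]] := partial_sum dJ.
(* [x i * p ^ J] is [b i] with digit [J] replaced by [n i] and the lower digits cleared. *)
pose x i := b i %/ p ^ J.+1 * p + n i.
have np i : n i < p by apply: leq_ltn_trans (nb i) _; rewrite ltn_pmod.
have xd k : \sum_i dig p (x i) k = dig p (d %/ p ^ J) k.
  case: k => [|k].
    rewrite dig0 -/(dig p d J) -sn; apply: eq_bigr => i _.
    by rewrite dig0 modnMDl modn_small.
  rewrite digS -divnMA -expnSr /dig -divnMA -expnD.
  rewrite -/(dig p d (J.+1 + k)) -dk ?leq_addr //.
  apply: eq_bigr => i _; rewrite -/(dig p (x i) k.+1) digS /dig.
  by rewrite /x divnMDl // (divn_small (np i)) addn0 -divnMA -expnD.
have mk := sum_modn_pow p1 xd.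
have qJ : 0 < p ^ J by rewrite expn_gt0 p0.
(* Modulo a power [p ^ M] exceeding all terms, [mk] becomes an equality of the numbers
   themselves. *)
have sx : \sum_i x i = d %/ p ^ J.
  pose M := d + \sum_i x i.
  have := mk M; rewrite (modn_small (m := _ %/ _)); last first.
    apply: leq_ltn_trans (leq_div _ _) (leq_ltn_trans _ (ltn_expl M p1)).
    exact: leq_addr.
  move=> <-; apply: eq_bigr => i _; rewrite modn_small //.
  apply: leq_ltn_trans (ltn_expl M p1).
  by rewrite /M (bigD1 i) //= addnCA leq_addr.
exists (fun i => x i * p ^ J), j; split.
- move=> i.
  have le : n i + (i == j) <= dig p (b i) J.
    by case: (i =P j) => [->|_]; rewrite ?addn1 ?addn0.
  rewrite -mulnDl /x -addnA.
  apply: leq_trans (leq_divM (b i) (p ^ J)); rewrite leq_mul2r; apply/orP; right.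
  rewrite [X in _ <= X](divn_eq _ p) expnSr divnMA leq_add2l.
  exact: le.
- by move=> i; apply: dvdn_mull.
- by rewrite -big_distrl /= sx -mulSnr -ltn_divLR.
- move=> k Jk; rewrite -(subnKC (ltnW Jk)) expnD.
  rewrite (eq_bigr (fun i => x i %% p ^ (k - J) * p ^ J)); last first.
    by move=> i _; rewrite muln_modl [_ ^ (k - J) * _]mulnC.
  rewrite -big_distrl /= mk -mulSnr mulnC leq_mul2l ltn_pmod ?orbT //.
  by rewrite expn_gt0 p0.
Qed.

Lemma polygt_digits p d r k (a : 'X_{1..r}) : 1 < p ->
  polygt (Qpv p k a) (Qp p d) ->
  exists J, dig p d J < \sum_i dig p (k * a i) J /\
    forall l, J < l -> \sum_i dig p (k * a i) l = dig p d l.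
Proof.
move=> p1 /polygt_qvP[N H].
(* Large enough for the comparison to hold and above every digit sum, which is at most [r * p]. *)
pose n := N + (r * p).+1.
pose L := (d + k * mdeg a).+1.
have aL i : k * a i < L.
  by rewrite /L ltnS (leq_trans _ (leq_addl _ _)) // leq_mul2l mdegE (bigD1 i) //= leq_addr orbT.
have := H n (leq_addr _ _).
rewrite -(qv_wide n (L := L)) // ?ltnS ?leq_addr //.
rewrite (eq_bigr (fun i => \sum_(l < L) dig p (k * a i) l * n ^ l)); last first.
  by move=> i _; rewrite (qv_wide n (L := L)).
rewrite exchange_big /=.
rewrite [X in _ < X](eq_bigr (fun l : 'I_L => (\sum_i dig p (k * a i) l) * n ^ l)); last first.
  by move=> l _; rewrite big_distrl.
move/(lex_digits (C := fun l => \sum_i dig p (k * a i) l)) => [|J [JL lt eqd]].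
  move=> l _; rewrite /n addnS ltnS (leq_trans _ (leq_addl _ _)) //.
  rewrite -[X in X * _]card_ord -sum_nat_const leq_sum // => i _.
  by rewrite ltnW // ltn_pmod // ltnW.
exists J; split=> // l Jl; have [lL|Ll] := ltnP l L; first by rewrite eqd ?Jl.
have dl : d <= l by apply: leq_trans Ll; rewrite /L -addnS leq_addr.
rewrite (dig_eq0 p1 dl).
by rewrite big1 // => i _; rewrite dig_eq0 // ltnW // (leq_trans (aL i)).
Qed.

(** In so large a base every number has a single digit. An auxiliary prime of this size handles the
    pairs with [k * mdeg a > d]. *)
Lemma big_prime_digits p d r (b : 'I_r -> nat) :
  1 < p -> d < p -> (forall i, b i < p) -> d < \sum_i b i ->
  dig p d 0 < \sum_i dig p (b i) 0 /\
    forall l, 0 < l -> \sum_i dig p (b i) l = dig p d l.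
Proof.
move=> p1 dp bp lt; split.
  rewrite dig0 modn_small // (eq_bigr b) // => i _.
  by rewrite dig0 modn_small.
case=> // l _; rewrite digS divn_small // dig_eq0 // big1 // => i _.
by rewrite digS divn_small // dig_eq0.
Qed.
End DigitComparison.

(** * Slots, orbit sums and the elements gamma *)

Lemma pair_of_var_idx r n (i : 'I_r) (j : 'I_n) : pair_of (var_idx i j) = (i, j).
Proof. by rewrite /pair_of /var_idx /mxvec_index cast_ordK enum_rankK. Qed.

Lemma var_idx_pair_of r n (k : 'I_(r * n)) :
  var_idx (pair_of k).1 (pair_of k).2 = k.
Proof.
rewrite /var_idx /mxvec_index /pair_of; set x := cast_ord _ k.
by case: (enum_val x) (enum_valK x) => i j /= ->; rewrite cast_ordKV.
Qed.

Lemma big_var_idx (R : Type) (idx : R) (op : Monoid.com_law idx) r n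
    (F : 'I_(r * n) -> R) :
  \big[op/idx]_k F k = \big[op/idx]_(j < n) \big[op/idx]_(i < r) F (var_idx i j).
Proof.
rewrite exchange_big pair_bigA /=.
rewrite (reindex (fun q : 'I_r * 'I_n => var_idx q.1 q.2)) //=.
exists (@pair_of r n) => [[i j] _|k _] /=; first by rewrite pair_of_var_idx.
by rewrite var_idx_pair_of.
Qed.

Section Slots.
Variables r n : nat.
Implicit Types (M : 'X_{1..r * n}) (t s : seq 'X_{1..r}) (v : 'X_{1..r}).

Definition slot M (j : 'I_n) : 'X_{1..r} := [multinom M (var_idx i j) | i < r].

Definition slots M : n.-tuple 'X_{1..r} := [tuple slot M j | j < n].

Lemma size_slots M : size (slots M) = n.
Proof. by rewrite size_tuple. Qed.

(** A short sequence is padded with zero vectors and a long one truncated, so [mon] also passes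
    between different numbers of slots. *)
Definition mon t : 'X_{1..r * n} :=
  [multinom nth 0%MM t (pair_of k).2 (pair_of k).1 | k < r * n].

Lemma slot_mon t j : slot (mon t) j = nth 0%MM t j.
Proof. by apply/mnmP => i; rewrite mnmE mnmE pair_of_var_idx. Qed.

Lemma nth_slots M (j : 'I_n) : nth 0%MM (slots M) j = slot M j.
Proof. by rewrite -tnth_nth tnth_mktuple. Qed.

Lemma slots_mon t : size t = n -> slots (mon t) = t :> seq _.
Proof.
move=> st; apply: (@eq_from_nth _ 0%MM); rewrite size_tuple // => j jn.
by rewrite (nth_slots _ (Ordinal jn)) slot_mon.
Qed.

Lemma slotsK M : mon (slots M) = M.
Proof.
by apply/mnmP => k; rewrite mnmE nth_slots mnmE var_idx_pair_of.
Qed.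

Definition wt s : 'X_{1..r} := (\sum_(v <- s) v)%MM.

Lemma wt_slots M : wt (slots M) = (\sum_(j < n) slot M j)%MM.
Proof. by rewrite /wt big_tuple; apply: eq_bigr => j _; rewrite tnth_mktuple. Qed.

Lemma wtE s i : wt s i = (\sum_(v <- s) v i)%N.
Proof. exact: mnm_sumE. Qed.

Lemma perm_wt s t : perm_eq s t -> wt s = wt t.
Proof. by move=> st; rewrite /wt (perm_big t). Qed.

Lemma mdeg_wt s : mdeg (wt s) = (\sum_(v <- s) mdeg v)%N.
Proof. exact: mdeg_sum. Qed.

Lemma mdeg_slots M : mdeg M = mdeg (wt (slots M)).
Proof.
rewrite wt_slots mdeg_sum mdegE (big_var_idx _ (fun k => M k)).
by apply: eq_bigr => j _; rewrite mdegE; apply: eq_bigr => i _; rewrite mnmE.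
Qed.

Definition nz s : nat := count (predC1 0%MM) s.

Lemma perm_nz s t : perm_eq s t -> nz s = nz t.
Proof. by move/seq.permP; apply. Qed.

Lemma perm_eq_nz s t : size s = size t ->
  (forall v, v != 0%MM -> count_mem v s = count_mem v t) -> perm_eq s t.
Proof.
move=> sst H.
have F : perm_eq (filter (predC1 0%MM) s) (filter (predC1 0%MM) t).
  rewrite /perm_eq; apply/allP => v _; apply/eqP; rewrite /= !count_filter.
  case: (eqVneq v 0%MM) => [->|nv].
    rewrite !(@eq_count _ _ pred0) ?count_pred0 // => x /=;
    by case: eqP.
  have E x : (predI (pred1 v) (predC1 0%MM)) x = pred1 v x.
    by rewrite /=; case: (x =P v) => [->|//]; rewrite nv.
  by rewrite !(eq_count E) H.
have Z (u : seq 'X_{1..r}) :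
    filter (predC (predC1 0%MM)) u = nseq (size u - nz u) 0%MM.
  have <- : size (filter (predC (predC1 0%MM)) u) = (size u - nz u)%N.
    by rewrite size_filter -(count_predC (predC1 0%MM) u) /nz addKn.
  by apply/all_pred1P/allP => x; rewrite mem_filter /= negbK => /andP[].
have N : nz s = nz t.
  by rewrite /nz -!size_filter; apply: perm_size.
rewrite -(perm_filterC (predC1 0%MM) s) perm_sym.
rewrite -(perm_filterC (predC1 0%MM) t) perm_sym.
by rewrite !Z sst N perm_cat2r.
Qed.

Lemma perm_slotsP M M' : reflect (exists s : 'S_n, forall j, slot M' j = slot M (s j))
  (perm_eq (slots M) (slots M')).
Proof.
apply: (iffP idP) => [|[s sE]].
  rewrite perm_sym => /tuple_permP[s sE]; exists s => j.
  have : slots M' = [tuple tnth (slots M) (s i) | i < n] by apply: val_inj.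
  by move/(congr1 (fun u => tnth u j)); rewrite !tnth_mktuple.
rewrite perm_sym; apply/tuple_permP; exists s.
by congr (tval _); apply: eq_from_tnth => j; rewrite !tnth_mktuple sE.
Qed.

End Slots.

Section MultiSymmetric.
Variables (A : comNzRingType) (r n : nat).
Implicit Types (M : 'X_{1..r * n}) (t s : seq 'X_{1..r}) (v : 'X_{1..r}).
Implicit Types (f g : {mpoly A[r * n]}).

Definition slot_perm_fun (s : 'S_n) (k : 'I_(r * n)) : 'I_(r * n) :=
  var_idx (pair_of k).1 (s (pair_of k).2).

Lemma slot_perm_inj (s : 'S_n) : injective (slot_perm_fun s).
Proof.
move=> k l /(congr1 (@pair_of r n)); rewrite !pair_of_var_idx.
case=> E1 /perm_inj E2; rewrite -(var_idx_pair_of k) -(var_idx_pair_of l).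
by rewrite E1 E2.
Qed.

Definition slot_perm (s : 'S_n) : 'S_(r * n) := perm (@slot_perm_inj s).

Lemma act_msym (s : 'S_n) f : Defs.act s f = msym (slot_perm s) f.
Proof.
rewrite /Defs.act /comp_mpoly /msym /mmap; apply: eq_bigr => M _; congr (_ * _).
apply: mmap1_eq => k; rewrite tnth_mktuple.
by rewrite permE.
Qed.

Lemma mcoeff_act (s : 'S_n) f M : exists M', (Defs.act s f)@_M = f@_M' /\
  forall j, slot M' j = slot M (s j).
Proof.
exists [multinom M (slot_perm s k) | k < r * n]; split.
  by rewrite act_msym mcoeff_sym.
move=> j; apply/mnmP => i; rewrite !mnmE permE /slot_perm_fun pair_of_var_idx //.
Qed.

Lemma slot_eq M M' : (forall j, slot M j = slot M' j) -> M = M'.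
Proof.
move=> E; rewrite -(slotsK M) -(slotsK M'); congr (mon n (tval _)).
by apply: eq_from_tnth => j; rewrite !tnth_mktuple.
Qed.

Lemma TS_mcoeffP f :
  TS f <-> forall M M', perm_eq (slots M) (slots M') -> f@_M = f@_M'.
Proof.
split=> [Tf M M' /perm_slotsP[s sE]|H s].
  have [M'' [E1 E2]] := mcoeff_act s f M.
  by rewrite -{1}(Tf s) E1; congr (f@__); apply: slot_eq => j; rewrite sE.
apply/mpolyP => M; have [M' [-> E]] := mcoeff_act s f M.
by apply/esym/H/perm_slotsP; exists s.
Qed.

Lemma TS_C c : TS (c%:MP : {mpoly A[r * n]}).
Proof. by move=> s; rewrite /Defs.act comp_mpolyC. Qed.

Lemma TS_D f g : TS f -> TS g -> TS (f + g).
Proof. by move=> Tf Tg s; rewrite /Defs.act rmorphD /= -!/(Defs.act _ _) Tf Tg. Qed.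

Lemma TS_M f g : TS f -> TS g -> TS (f * g).
Proof. by move=> Tf Tg s; rewrite /Defs.act rmorphM /= -!/(Defs.act _ _) Tf Tg. Qed.

Lemma TS_Z c f : TS f -> TS (c *: f).
Proof. by move=> Tf; rewrite -mul_mpolyC; apply/TS_M/Tf/TS_C. Qed.

Lemma TS_B f g : TS f -> TS g -> TS (f - g).
Proof. by move=> Tf Tg; rewrite -scaleN1r; apply/TS_D/TS_Z. Qed.

(** [permutations] lists distinct rearrangements, so each monomial of the orbit occurs with
    coefficient one. *)
Definition orb s : {mpoly A[r * n]} := \sum_(t <- permutations s) 'X_[mon n t].

Lemma mcoeff_orb s M : size s = n -> (orb s)@_M = (perm_eq (slots M) s)%:R.
Proof.
move=> ss; rewrite /orb raddf_sum /=.
have E t : t \in permutations s -> ('X_[mon n t] : {mpoly A[r * n]})@_M = (t == slots M)%:R.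
  rewrite mem_permutations => /perm_size; rewrite ss => st.
  rewrite mcoeffX; congr ((_ : bool)%:R); apply/eqP/eqP => [<-|->].
    by rewrite slots_mon.
  by rewrite slotsK.
rewrite (eq_big_seq _ E) -mem_permutations.
have [sM|sM] := boolP (tval (slots M) \in permutations s).
  rewrite (bigD1_seq (tval (slots M))) ?permutations_uniq //= eqxx big1 ?addr0 //.
  by move=> t /negbTE ->.
by rewrite big_seq big1 // => t ts; case: eqP sM => // <-; rewrite ts.
Qed.

Lemma TS_orb s : size s = n -> TS (orb s).
Proof.
move=> ss; apply/TS_mcoeffP => M M' MM'; rewrite !mcoeff_orb //.
by rewrite (permPl MM').
Qed.

Lemma msupp_orb s M : size s = n -> M \in msupp (orb s) -> perm_eq (slots M) s.
Proof.
move=> ss; rewrite mcoeff_msupp mcoeff_orb //.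
by case: perm_eq => //; rewrite eqxx.
Qed.

(** Orbits are peeled off one at a time: subtracting a multiple of one orbit sum clears that orbit
    from the support and leaves the other coefficients unchanged. *)
Lemma TS_ind (P : {mpoly A[r * n]} -> Prop) f : TS f -> P 0 ->
  (forall g h, P g -> P h -> P (g + h)) ->
  (forall M, M \in msupp f -> P (f@_M *: orb (slots M))) -> P f.
Proof.
move=> Tf P0 PD PM.
(* The surviving coefficients remain those of [f], so the hypothesis on monomials of [f] stays
   applicable. *)
suff H m g : (size (msupp g) < m)%N -> (forall M, g@_M != 0 -> g@_M = f@_M) ->
    TS g -> P g by exact: (H _ f (ltnSn _)).
elim: m g => // m IH g lt gE Tg.
have [->//|g0] := eqVneq g 0.
have [M Mg] : exists M, M \in msupp g.
  by exists (mlead g); apply: mlead_supp.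
have gM : g@_M != 0 by rewrite -mcoeff_msupp.
rewrite -[g](subrK (g@_M *: orb (slots M))).
have hE M' : (g - g@_M *: orb (slots M))@_M' =
    if perm_eq (slots M') (slots M) then 0 else g@_M'.
  rewrite mcoeffB mcoeffZ mcoeff_orb ?size_tuple //.
  case: ifP => pe; last by rewrite mulr0 subr0.
  by rewrite mulr1 (proj1 (TS_mcoeffP g) Tg _ _ pe) subrr.
apply: PD; last by rewrite gE //; apply: PM; rewrite mcoeff_msupp -gE.
apply: IH.
- rewrite ltnS in lt; apply: leq_trans lt.
  apply: (@uniq_leq_size _ (M :: msupp (g - g@_M *: orb (slots M)))).
    by rewrite /= msupp_uniq mcoeff_msupp hE perm_refl eqxx.
  move=> M'; rewrite in_cons => /orP[/eqP->//|].
  by rewrite mcoeff_msupp hE; case: ifP => [_|_ H]; rewrite ?eqxx // mcoeff_msupp.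
- by move=> M'; rewrite hE; case: ifP => [_|_ /gE//]; rewrite eqxx.
- by apply: TS_B => //; apply/TS_Z/TS_orb; rewrite size_tuple.
Qed.

Definition setmon v (S : {set 'I_n}) : 'X_{1..r * n} :=
  mon n [tuple if j \in S then v else 0%MM | j < n].

Lemma slot_setmon v S j : slot (setmon v S) j = if j \in S then v else 0%MM.
Proof. by rewrite slot_mon -tnth_nth tnth_mktuple. Qed.

Lemma gamE k v : gam A n k v = \sum_(S : {set 'I_n} | #|S| == k) 'X_[setmon v S].
Proof.
apply: eq_bigr => S _; rewrite mpolyXE_id.
rewrite (big_var_idx _ (fun l => 'X_l ^+ setmon v S l)) big_mkcond /=.
apply: eq_bigr => j _.
have E i : setmon v S (var_idx i j) = (if j \in S then v else 0%MM) i.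
  by rewrite -slot_setmon [RHS]mnmE.
under [RHS]eq_bigr => i _ do rewrite E.
by case: ifP => // _; rewrite big1 // => i _; rewrite mnm0E expr0.
Qed.

Lemma wt_setmon v S : wt (slots (setmon v S)) = (v *+ #|S|)%MM.
Proof.
apply/mnmP => i; rewrite wt_slots mnm_sumE mulmnE.
rewrite (eq_bigr (fun j => if j \in S then v i else 0)%N); last first.
  by move=> j _; rewrite slot_setmon; case: ifP; rewrite ?mnm0E.
by rewrite -big_mkcond /= sum_nat_const mulnC.
Qed.

Lemma setmon_inj v : v != 0%MM -> injective (setmon v).
Proof.
move=> nv S S' E; apply/setP => j; have := congr1 (fun M => slot M j) E.
rewrite !slot_setmon; case: ifP; case: ifP => // _ _ /eqP; last by rewrite eq_sym (negbTE nv).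
by rewrite (negbTE nv).
Qed.

(** As [v] is nonzero, a set of slots is recovered from its monomial as the slots carrying [v]; each
    monomial of the orbit thus arises from exactly one set. *)
Lemma gam_orb k v : v != 0%MM -> (k <= n)%N ->
  gam A n k v = orb (nseq k v ++ nseq (n - k) 0%MM).
Proof.
move=> nv kn; set s0 := _ ++ _.
have ss0 : size s0 = n by rewrite size_cat !size_nseq subnKC.
have c0 x : x != 0%MM -> count_mem x s0 = ((v == x) * k)%N.
  move=> nx; rewrite count_cat !count_nseq /= [0%MM == x]eq_sym (negbTE nx).
  by rewrite addn0.
apply/mpolyP => M; rewrite gamE mcoeff_orb // raddf_sum /=.
have cS S x : x != 0%MM -> count_mem x (slots (setmon v S)) = ((v == x) * #|S|)%N.
  move=> nx; rewrite -sum1_count big_tuple -sum1_card.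
  rewrite [LHS](eq_bigl (fun j => (j \in S) && (v == x))); last first.
    move=> j; rewrite tnth_mktuple slot_setmon /=.
    by case: ifP => //; rewrite [0%MM == x]eq_sym (negbTE nx).
  case: eqP => _; last by rewrite mul0n big1 // => j; rewrite andbF.
  by rewrite mul1n; apply: eq_bigl => j; rewrite andbT.
have [pe|npe] := boolP (perm_eq _ _); last first.
  rewrite big1 // => S /eqP Sk; rewrite mcoeffX; case: eqP => // E.
  case/negP: npe; rewrite -E; apply: perm_eq_nz; rewrite ?ss0 ?size_slots // => x nx.
  by rewrite cS // c0 // Sk.
pose S := [set j | slot M j == v].
have SM : setmon v S = M.
  apply: slot_eq => j; rewrite slot_setmon inE; case: eqP => [->//|ne].
  have : nth 0%MM (slots M) j \in s0.
    by rewrite -(perm_mem pe) mem_nth // size_slots.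
  rewrite nth_slots mem_cat => /orP[] /nseqP[] // E.
have Sk : #|S| = k.
  move/seq.permP/(_ (pred1 v)): pe; rewrite c0 // eqxx mul1n => <-.
  by rewrite -SM cS // eqxx mul1n.
rewrite (bigD1 S) /= ?Sk // mcoeffX SM eqxx big1 ?addr0 // => S' /andP[_ ne].
by rewrite mcoeffX -SM (inj_eq (setmon_inj nv)) (negbTE ne).
Qed.

Lemma gam_gt k v : (n < k)%N -> gam A n k v = 0.
Proof.
move=> nk; rewrite gamE big1 // => S /eqP Sk.
by have := max_card (mem S); rewrite Sk card_ord leqNgt nk.
Qed.

Lemma TS_gam k v : v != 0%MM -> TS (gam A n k v).
Proof.
move=> nv; have [kn|nk] := leqP k n.
  by rewrite gam_orb //; apply: TS_orb; rewrite size_cat !size_nseq subnKC.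
by rewrite gam_gt // -mpolyC0; apply: TS_C.
Qed.


Lemma mcoeff_gam_neq0 k v M : (gam A n k v)@_M != 0 -> wt (slots M) = (v *+ k)%MM.
Proof.
move=> H; apply/eqP; apply: contraR H => ne; rewrite gamE raddf_sum /= big1 // => S /eqP Sk.
by rewrite mcoeffX; case: eqP => // E; case/eqP: ne; rewrite -E wt_setmon Sk.
Qed.

End MultiSymmetric.

Section GenAlg.
Variables (A : comNzRingType) (n : nat).
Implicit Types (G H : {mpoly A[n]} -> Prop) (f g : {mpoly A[n]}).

Lemma ga_scale G c f : gen_alg G f -> gen_alg G (c *: f).
Proof. by move=> Gf; rewrite -mul_mpolyC; apply: ga_mul => //; apply: ga_const. Qed.

Lemma ga_zero G : gen_alg G 0.
Proof. by rewrite -mpolyC0; apply: ga_const. Qed.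

Lemma ga_sub G f g : gen_alg G f -> gen_alg G g -> gen_alg G (f - g).
Proof. by move=> Gf Gg; rewrite -scaleN1r; apply/ga_add/ga_scale. Qed.

Lemma ga_sum G (I : Type) (u : seq I) (P : pred I) F :
  (forall i, P i -> gen_alg G (F i)) -> gen_alg G (\sum_(i <- u | P i) F i).
Proof. by move=> H; elim/big_rec: _ => [|i x Pi Gx]; [apply: ga_zero|apply: ga_add; auto]. Qed.

Lemma ga_exp G f k : gen_alg G f -> gen_alg G (f ^+ k).
Proof.
move=> Gf; elim: k => [|k IH]; first by rewrite expr0 -mpolyC1; apply: ga_const.
by rewrite exprS; apply: ga_mul.
Qed.

Lemma ga_prod G (I : Type) (u : seq I) (P : pred I) F :
  (forall i, P i -> gen_alg G (F i)) -> gen_alg G (\prod_(i <- u | P i) F i).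
Proof.
move=> H; elim/big_rec: _ => [|i x Pi Gx]; last by apply: ga_mul; auto.
by rewrite -mpolyC1; apply: ga_const.
Qed.

Lemma ga_trans G H f : (forall g, G g -> gen_alg H g) -> gen_alg G f -> gen_alg H f.
Proof.
by move=> GH; elim=> [g /GH//|c|p q _ Hp _ Hq|p q _ Hp _ Hq];
  [apply: ga_const|apply: ga_add|apply: ga_mul].
Qed.

End GenAlg.

(** * Indecomposables in a given multidegree *)

Lemma msize_leP (R : comNzRingType) n (p : {mpoly R[n]}) m :
  reflect (forall M, M \in msupp p -> (mdeg M < m)%N) (msize p <= m)%N.
Proof.
rewrite msizeE; apply: (iffP (bigmax_leqP_seq _ _ _ _)) => H M Mp; first exact: H.
by move=> _; apply: H.
Qed.

Section LowDegree.
Variables (A : comNzRingType) (r n : nat).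
Implicit Types (f g h : {mpoly A[r * n]}) (s t : seq 'X_{1..r}) (v b : 'X_{1..r}).

(** [msize] is the degree plus one, so the bound means degree less than [m]; in degree [m] these
    elements generate only decomposables. *)
Definition lowTS m g : Prop := TS g /\ (msize g <= m)%N.

Lemma msize_gam k v : (msize (gam A n k v) <= (k * mdeg v).+1)%N.
Proof.
apply/msize_leP => M; rewrite mcoeff_msupp => /mcoeff_gam_neq0.
by rewrite mdeg_slots => ->; rewrite mdegMn mulnC.
Qed.

Lemma low_gam m k v : v != 0%MM -> (k * mdeg v < m)%N ->
  gen_alg (lowTS m) (gam A n k v).
Proof.
move=> nv lt; apply: ga_gen; split; first exact: TS_gam.
exact: leq_trans (msize_gam _ _) lt.
Qed.

Lemma low_orb m s : size s = n -> (mdeg (wt s) < m)%N ->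
  gen_alg (lowTS m) (orb A n s).
Proof.
move=> ss lt; apply: ga_gen; split; first exact: TS_orb.
by apply/msize_leP => M /(msupp_orb ss) /perm_wt E; rewrite mdeg_slots E.
Qed.

Definition slot_pow v : n.-tuple {mpoly A[r * n]} :=
  [tuple \prod_(i < r) 'X_(var_idx i j) ^+ v i | j < n].

Lemma mesym_slot_pow k v : mesym n A k \mPo slot_pow v = gam A n k v.
Proof.
rewrite /mesym raddf_sum /=; apply: eq_bigr => S _.
rewrite rmorph_prod /=; apply: eq_bigr => j _.
by rewrite comp_mpolyXU -tnth_nth tnth_mktuple.
Qed.

Definition pow_vars m : n.-tuple {mpoly A[n]} := [tuple 'X_j ^+ m | j < n].

Lemma mesym_pow_slot_pow k m v :
  (mesym n A k \mPo pow_vars m) \mPo slot_pow v = gam A n k (v *+ m)%MM.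
Proof.
rewrite /mesym [X in X \mPo slot_pow v]raddf_sum /= raddf_sum /=; apply: eq_bigr => S _.
rewrite !rmorph_prod /=; apply: eq_bigr => j _.
rewrite comp_mpolyXU -tnth_nth tnth_mktuple rmorphXn /=.
rewrite comp_mpolyXU -tnth_nth tnth_mktuple -prodrXl.
by apply: eq_bigr => i _; rewrite mulmnE exprM.
Qed.

Lemma mesym_pow_sym k m : mesym n A k \mPo pow_vars m \is symmetric.
Proof.
apply: msym_comp_poly; first exact: mesym_sym.
move=> s; rewrite perm_sym; apply/tuple_permP; exists s.
congr (tval _); apply: eq_from_tnth => j; rewrite !tnth_mktuple.
rewrite -tnth_nth tnth_mktuple rmorphXn /= /msym mmapX mmap1U //.
Qed.

Lemma msize_mesym_pow k m : (msize (mesym n A k \mPo pow_vars m) <= (k * m).+1)%N.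
Proof.
rewrite mesymE raddf_sum /=; apply: leq_trans (mmeasure_sum _ _ _ _) _.
apply/bigmax_leqP => S /eqP Sk.
have -> : 'X_[mesym1 S] \mPo pow_vars m = 'X_[(mesym1 S *+ m)%MM].
  rewrite comp_mpolyX mpolyXE_id; apply: eq_bigr => i _.
  by rewrite tnth_mktuple mulmnE mulnC exprM.
by rewrite mmeasureX /= mdegMn mdeg_mesym1 Sk.
Qed.

(* The fundamental theorem of symmetric polynomials, applied to the power
   [x ^ v] in each slot: only one monomial in the elementary symmetric
   polynomials has full weight without splitting the degree. *)
Lemma gam_mulmn k m v : v != 0%MM -> (0 < k * m)%N ->
  exists c, gen_alg (lowTS (k * m * mdeg v))
    (gam A n k (v *+ m)%MM - c *: gam A n (k * m) v).
Proof.
move=> nv km0.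
have [t [tE tw]] := sym_fundamental (mesym_pow_sym k m).
have := mesym_pow_slot_pow k m v; rewrite -tE => <-.
have {tw} tw := leq_trans tw (msize_mesym_pow k m).
rewrite [t \mPo _]comp_mpolyE raddf_sum /=.
pose G (M : 'X_{1..n}) := \prod_(i < n) gam A n i.+1 v ^+ M i.
have E M : (t@_M *: (\prod_(i < n) tnth [tuple mesym n A i0.+1 | i0 < n] i ^+ M i))
    \mPo slot_pow v = t@_M *: G M.
  rewrite comp_mpolyZ rmorph_prod /=; congr (_ *: _); apply: eq_bigr => i _.
  by rewrite rmorphXn /= tnth_mktuple mesym_slot_pow.
rewrite (eq_bigr _ (fun M _ => E M)) => {E}.
(* With [k * m > n] there is no elementary symmetric polynomial of index [k * m], and every factor
   has lower degree. *)
have [le|lt] := leqP (k * m) n; last first.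
  exists 0; rewrite scale0r subr0; apply: ga_sum => M _; apply/ga_scale/ga_prod => i _.
  apply/ga_exp/low_gam => //; rewrite ltn_pmul2r ?mdeg_gt0 //; last first.
    by rewrite lt0n mdeg_eq0.
  by apply: leq_ltn_trans lt; apply: ltn_ord.
have ltk : ((k * m).-1 < n)%N by rewrite prednK.
pose i0 := Ordinal ltk.
have GU : G U_(i0)%MM = gam A n (k * m) v.
  rewrite /G (bigD1 i0) //= mnm1E eqxx expr1 big1 ?mulr1 ?prednK // => i ne.
  by rewrite mnm1E eq_sym (negbTE ne) expr0.
exists t@_U_(i0); rewrite -GU.
have -> : t@_U_(i0) *: G U_(i0)%MM = \sum_(M <- msupp t | M == U_(i0)%MM) t@_M *: G M.
  rewrite -big_filter; have [Ut|Ut] := boolP (U_(i0)%MM \in msupp t).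
    by rewrite filter_pred1_uniq ?msupp_uniq // big_seq1.
  rewrite (memN_msupp_eq0 Ut) scale0r big_filter big_seq_cond big1 // => M /andP[Mt /eqP ME].
  by rewrite -ME Mt in Ut.
rewrite (bigID (pred1 U_(i0)%MM)) /= addrAC subrr add0r.
rewrite big_seq_cond; apply: ga_sum => M /andP[Mt ne].
apply/ga_scale/ga_prod => i _.
have [->|Mi] := posnP (M i).
  by rewrite expr0 -mpolyC1; apply: ga_const.
have wM : (mnmwgt M <= k * m)%N.
  by have := leq_trans (mmeasure_mnm_lt _ Mt) tw; rewrite ltnS.
have leM : (i.+1 <= mnmwgt M)%N.
  rewrite /mnmwgt (bigD1 i) //= (leq_trans _ (leq_addr _ _)) //.
  by rewrite leq_pmull.
apply/ga_exp/low_gam => //; rewrite ltn_pmul2r; last by rewrite lt0n mdeg_eq0.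
(* A factor of index [k * m] exhausts the weight, which leaves only the monomial [U_(i0)]. *)
rewrite ltn_neqAle (leq_trans leM wM) andbT; apply: contra_neq ne => ikm.
have ii0 : i = i0 by apply: val_inj => /=; rewrite -ikm.
subst i; apply/mnmP => j; rewrite mnm1E.
have H : (M i0 * i0.+1 + \sum_(l < n | l != i0) M l * l.+1 <= k * m)%N.
  by move: wM; rewrite /mnmwgt (bigD1 i0).
have Mi1 : M i0 = 1%N.
  move: H Mi; rewrite ikm; case: (M i0) => [|[|x]] //; rewrite !mulSn; lia.
have R0 : (\sum_(l < n | l != i0) M l * l.+1 = 0)%N.
  by move: H; rewrite Mi1 mul1n ikm; lia.
case: (eqVneq i0 j) => [<-//|nj].
move/eqP: R0; rewrite sum_nat_eq0 => /forallP/(_ j).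
by rewrite eq_sym nj /= muln_eq0 orbF => /eqP.
Qed.


End LowDegree.

Section Gcd.
Variable r : nat.
Implicit Types (v b : 'X_{1..r}).

Lemma mgcd_dvd v i : (mgcd v %| v i)%N.
Proof. by rewrite /mgcd (bigD1 i) //= dvdn_gcdl. Qed.

Lemma dvdn_mgcd v q : (forall i, q %| v i)%N -> (q %| mgcd v)%N.
Proof.
by move=> H; rewrite /mgcd; elim/big_rec: _ => [|i x _ qx]; rewrite ?dvdn0 // dvdn_gcd H.
Qed.

Lemma mgcd_mulmn v k : mgcd (v *+ k)%MM = (k * mgcd v)%N.
Proof.
rewrite /mgcd; elim/big_rec2: _ => [|i x y _ ->]; first by rewrite muln0.
by rewrite mulmnE mulnC muln_gcdr.
Qed.

Lemma mgcd_gt0 v : v != 0%MM -> (0 < mgcd v)%N.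
Proof.
move=> nv; rewrite lt0n; apply: contra nv => /eqP v0; apply/eqP/mnmP => i.
by have := mgcd_dvd v i; rewrite v0 dvd0n mnm0E => /eqP.
Qed.

Definition divm v q : 'X_{1..r} := [multinom (v i %/ q)%N | i < r].

Lemma divmK v q : (forall i, q %| v i)%N -> (divm v q *+ q)%MM = v.
Proof. by move=> H; apply/mnmP => i; rewrite mulmnE mnmE divnK. Qed.

Definition prim b := divm b (mgcd b).

Lemma primK b : (prim b *+ mgcd b)%MM = b.
Proof. by apply: divmK => i; apply: mgcd_dvd. Qed.

Lemma prim_neq0 b : b != 0%MM -> prim b != 0%MM.
Proof.
move=> nb; apply: contra nb => /eqP E; rewrite -(primK b) E.
by apply/eqP/mnmP => i; rewrite mulmnE mnm0E.
Qed.

Lemma mgcd_prim b : b != 0%MM -> mgcd (prim b) = 1%N.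
Proof.
move=> nb; have := mgcd_mulmn (prim b) (mgcd b); rewrite primK.
move/eqP; rewrite -{1}[mgcd b]muln1 eqn_pmul2l ?mgcd_gt0 //.
by move/eqP.
Qed.

Lemma mulmnI v v' k : (0 < k)%N -> (v *+ k)%MM = (v' *+ k)%MM -> v = v'.
Proof.
move=> k0 /mnmP E; apply/mnmP => i; have := E i; rewrite !mulmnE => /eqP.
by rewrite eqn_pmul2r // => /eqP.
Qed.

Lemma mulmnA v k m : (v *+ k *+ m)%MM = (v *+ (k * m))%MM.
Proof. by apply/mnmP => i; rewrite !mulmnE mulnA. Qed.

Lemma mulmn_eq0 v k : (v *+ k == 0)%MM = (v == 0%MM) || (k == 0%N).
Proof. by rewrite -!mdeg_eq0 mdegMn muln_eq0. Qed.

Lemma prim_mulmn v k : (v *+ k)%MM != 0%MM -> v = (prim (v *+ k) *+ mgcd v)%MM.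
Proof.
rewrite mulmn_eq0 negb_or => /andP[nv]; rewrite -lt0n => k0.
apply: (mulmnI k0); rewrite mulmnA [(mgcd v * k)%N]mulnC -mgcd_mulmn.
by rewrite primK.
Qed.

End Gcd.

Section Indecomposables.
Variables (A : comNzRingType) (r n : nat).
Implicit Types (f g h : {mpoly A[r * n]}) (s t : seq 'X_{1..r}) (v b x : 'X_{1..r}).

Definition zipadd t1 t2 : seq 'X_{1..r} :=
  [tuple (nth 0%MM t1 j + nth 0%MM t2 j)%MM | j < n].

Definition disj t1 t2 :=
  [forall j : 'I_n, (nth 0%MM t1 j == 0%MM) || (nth 0%MM t2 j == 0%MM)].

Lemma nth_zipadd t1 t2 (j : 'I_n) :
  nth 0%MM (zipadd t1 t2) j = (nth 0%MM t1 j + nth 0%MM t2 j)%MM.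
Proof. by rewrite -tnth_nth tnth_mktuple. Qed.

Lemma size_zipadd t1 t2 : size (zipadd t1 t2) = n.
Proof. by rewrite size_tuple. Qed.

Lemma mon_zipadd t1 t2 : (mon n t1 + mon n t2)%MM = mon n (zipadd t1 t2).
Proof. by apply/mnmP => k; rewrite mnmDE !mnmE nth_zipadd mnmDE. Qed.

Lemma count_nth (a : pred 'X_{1..r}) t : size t = n ->
  count a t = (\sum_(j < n) a (nth 0%MM t j))%N.
Proof.
move=> st; rewrite -sum1_count (big_nth 0%MM) st big_mkord big_mkcond /=.
by apply: eq_bigr => j _; case: (a _).
Qed.

Lemma count_zipadd x t1 t2 : x != 0%MM -> size t1 = n -> size t2 = n ->
  disj t1 t2 ->
  count_mem x (zipadd t1 t2) = (count_mem x t1 + count_mem x t2)%N.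
Proof.
move=> nx st1 st2 /forallP D; rewrite !count_nth ?size_zipadd // -big_split /=.
apply: eq_bigr => j _; rewrite nth_zipadd.
case/orP: (D j) => /eqP ->; rewrite ?add0m ?addm0 [0%MM == x]eq_sym (negbTE nx) //.
by rewrite addn0.
Qed.

Lemma wt_zipadd t1 t2 : size t1 = n -> size t2 = n ->
  wt (zipadd t1 t2) = (wt t1 + wt t2)%MM.
Proof.
move=> st1 st2; rewrite /wt !(big_nth 0%MM) size_zipadd st1 st2 !big_mkord.
rewrite -big_split /=; apply: eq_bigr => j _; exact: nth_zipadd.
Qed.

Lemma nz_zipadd t1 t2 : size t1 = n -> size t2 = n -> ~~ disj t1 t2 ->
  (nz (zipadd t1 t2) < nz t1 + nz t2)%N.
Proof.
move=> st1 st2; rewrite negb_forall => /existsP[j0].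
rewrite negb_or => /andP[n1 n2].
rewrite /nz !count_nth ?size_zipadd // -big_split /= (bigD1 j0) //=.
rewrite [X in (_ < X)%N](bigD1 j0) //= n1 n2.
rewrite -[X in (X < _)%N]addn0 -addnA -addSn leq_add //.
  by rewrite ltnS leq_b1.
rewrite addn0; apply: leq_sum => j _; rewrite nth_zipadd mnmD_eq0 negb_and.
by case: (_ == _); case: (_ == _).
Qed.

Section Split.
Variables (s : seq 'X_{1..r}) (v : 'X_{1..r}).
Hypothesis ss : size s = n.
Hypothesis nv : v != 0%MM.

Definition part1 t : seq 'X_{1..r} := [seq if x == v then v else 0%MM | x <- t].
Definition part2 t : seq 'X_{1..r} := [seq if x == v then 0%MM else x | x <- t].

Lemma nth_part1 t j : nth 0%MM (part1 t) j =
  if nth 0%MM t j == v then v else 0%MM.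
Proof.
have [lt|le] := ltnP j (size t); first by rewrite (nth_map 0%MM).
by rewrite !nth_default ?size_map // eq_sym (negbTE nv).
Qed.

Lemma nth_part2 t j : nth 0%MM (part2 t) j =
  if nth 0%MM t j == v then 0%MM else nth 0%MM t j.
Proof.
have [lt|le] := ltnP j (size t); first by rewrite (nth_map 0%MM).
by rewrite !nth_default ?size_map // if_same.
Qed.

Lemma disj_parts t : disj (part1 t) (part2 t).
Proof.
by apply/forallP => j; rewrite nth_part1 nth_part2; case: ifP; rewrite eqxx ?orbT.
Qed.

Lemma zipadd_parts t : size t = n -> zipadd (part1 t) (part2 t) = t.
Proof.
move=> st; apply: (@eq_from_nth _ 0%MM); rewrite size_zipadd // => j jn.
rewrite (nth_zipadd _ _ (Ordinal jn)) /= nth_part1 nth_part2.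
by case: eqP => [->|_]; rewrite ?addm0 ?add0m.
Qed.

Lemma perm_zipadd t1 t2 : perm_eq t1 (part1 s) -> perm_eq t2 (part2 s) ->
  disj t1 t2 ->
  [/\ perm_eq (zipadd t1 t2) s, part1 (zipadd t1 t2) = t1
    & part2 (zipadd t1 t2) = t2].
Proof.
move=> p1 p2 D.
have st1 : size t1 = n by rewrite (perm_size p1) size_map.
have st2 : size t2 = n by rewrite (perm_size p2) size_map.
have vals j : (j < n)%N -> [\/ nth 0%MM t1 j = v /\ nth 0%MM t2 j = 0%MM
     | nth 0%MM t1 j = 0%MM /\ nth 0%MM t2 j <> v].
  move=> jn; have /mapP[x _ E] : nth 0%MM t1 j \in part1 s.
    by rewrite -(perm_mem p1) mem_nth ?st1.
  have /mapP[y _ E2] : nth 0%MM t2 j \in part2 s.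
    by rewrite -(perm_mem p2) mem_nth ?st2.
  move: E; case: ifP => _ E.
    by left; split=> //; have /forallP/(_ (Ordinal jn)) := D;
       rewrite /= E (negbTE nv) => /eqP.
  right; split=> //; rewrite E2; case: eqP => // _; apply/eqP.
  by rewrite eq_sym.
split.
- apply: perm_eq_nz => [|x nx]; first by rewrite size_zipadd.
  rewrite count_zipadd // (seq.permP p1) (seq.permP p2).
  by rewrite -count_zipadd ?size_map ?disj_parts // zipadd_parts.
- apply: (@eq_from_nth _ 0%MM); rewrite size_map size_zipadd // => j jn.
  rewrite nth_part1 (nth_zipadd _ _ (Ordinal jn)) /=.
  case: (vals j jn) => -[-> H]; first by rewrite H addm0 eqxx.
  by rewrite add0m; case: eqP.
- apply: (@eq_from_nth _ 0%MM); rewrite size_map size_zipadd // => j jn.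
  rewrite nth_part2 (nth_zipadd _ _ (Ordinal jn)) /=.
  case: (vals j jn) => -[-> H]; first by rewrite H addm0 eqxx.
  by rewrite add0m; case: eqP.
Qed.

(** Pairs of arrangements without a common nonzero slot correspond bijectively to arrangements of
    [s], through [part1] and [part2] in one direction and [zipadd] in the other. The subtracted sum
    collects the overlapping pairs. *)
Lemma orb_parts :
  orb A n s = orb A n (part1 s) * orb A n (part2 s)
   - \sum_(q <- [seq (t1, t2) | t1 <- permutations (part1 s),
                                t2 <- permutations (part2 s)] | ~~ disj q.1 q.2)
      'X_[mon n (zipadd q.1 q.2)].
Proof.
set prs := [seq _ | _ <- _, _ <- _].
have -> : orb A n (part1 s) * orb A n (part2 s) =
    \sum_(q <- prs) 'X_[mon n (zipadd q.1 q.2)].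
  rewrite /orb big_distrl /= big_allpairs /=; apply: eq_bigr => t1 _.
  by rewrite big_distrr /=; apply: eq_bigr => t2 _; rewrite -mpolyXD mon_zipadd.
rewrite (bigID (fun q => disj q.1 q.2)) /= addrK -big_filter.
have pe : perm_eq [seq (part1 t, part2 t) | t <- permutations s]
   [seq q <- prs | disj q.1 q.2].
  have spt t : t \in permutations s -> size t = n.
    by rewrite mem_permutations => /perm_size ->.
  apply: uniq_perm.
  - rewrite map_inj_in_uniq ?permutations_uniq // => t t' /spt st /spt st' [E1 E2].
    by rewrite -(zipadd_parts st) -(zipadd_parts st') E1 E2.
  - by rewrite filter_uniq // allpairs_uniq ?permutations_uniq // => -[? ?] [? ?].
  move=> [t1 t2]; rewrite mem_filter /=; apply/mapP/andP.
    move=> [t tp [-> ->]]; split; first exact: disj_parts.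
    move: tp; rewrite mem_permutations => tp.
    by apply: allpairs_f; rewrite mem_permutations perm_map.
  move=> [D /allpairsP[[u1 u2] /= [u1p u2p [E1 E2]]]].
  rewrite !mem_permutations -E1 -E2 in u1p u2p.
  have [H1 H2 H3] := perm_zipadd u1p u2p D.
  by exists (zipadd t1 t2); rewrite ?mem_permutations // H2 H3.
rewrite -(perm_big _ pe) /= big_map /orb; apply: eq_big_seq => t.
by rewrite mem_permutations /= => /perm_size tp; rewrite zipadd_parts // tp.
Qed.

End Split.

Lemma orb_perm s t : perm_eq s t -> orb A n s = orb A n t.
Proof. by move=> /perm_permutations pe; rewrite /orb (perm_big _ pe). Qed.

Definition decomp b f : Prop :=
  exists c, gen_alg (lowTS (mdeg b)) (f - c *: gam A n (mgcd b) (prim b)).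

Lemma decomp_gam k v : (v *+ k)%MM != 0%MM -> decomp (v *+ k)%MM (gam A n k v).
Proof.
move=> nvk; have := nvk; rewrite mulmn_eq0 negb_or -lt0n => /andP[nv k0].
set b := (v *+ k)%MM in nvk *.
have vE : (prim b *+ mgcd v)%MM = v by rewrite -prim_mulmn.
have km0 : (0 < k * mgcd v)%N by rewrite muln_gt0 k0 mgcd_gt0.
have := @gam_mulmn A r n k (mgcd v) (prim b) (prim_neq0 nvk) km0.
rewrite vE -mgcd_mulmn -/b.
have -> : (mgcd b * mdeg (prim b) = mdeg b)%N.
  by rewrite mulnC -mdegMn primK.
by [].
Qed.

Lemma decompD b f g : decomp b f -> decomp b g -> decomp b (f + g).
Proof.
move=> [c Hc] [e He]; exists (c + e); rewrite scalerDl opprD addrACA.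
exact: ga_add.
Qed.

Lemma decompZ b a f : decomp b f -> decomp b (a *: f).
Proof.
move=> [c Hc]; exists (a * c); rewrite -scalerA -scalerBr.
exact: ga_scale.
Qed.

Lemma decomp_low b f : gen_alg (lowTS (mdeg b)) f -> decomp b f.
Proof. by move=> H; exists 0; rewrite scale0r subr0. Qed.

(* Induction on the number of nonzero slots: splitting off the slots that carry
   a fixed vector changes an orbit sum by a product of two orbit sums of lower
   degree and by orbit sums with fewer nonzero slots. *)
Lemma decomp_TS b f : b != 0%MM -> TS f ->
  (forall M, M \in msupp f -> wt (slots M) = b) -> decomp b f.
Proof.
move=> nb.
have [L] : exists L, forall M, M \in msupp f -> (nz (slots M) < L)%N.
  exists n.+1 => M _; rewrite ltnS -[X in (_ <= X)%N](size_slots M).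
  exact: count_size.
elim: L f => [|L IH] f nzf Tf wf.
  have -> : f = 0.
    by apply/eqP/contraT => /mlead_supp /nzf.
  by apply: decomp_low; apply: ga_zero.
apply: TS_ind Tf _ _ _.
- by apply: decomp_low; apply: ga_zero.
- by move=> g h; apply: decompD.
move=> M Mf; apply: decompZ.
have {Mf wf nzf} [wM nzM] := (wf _ Mf, nzf _ Mf).
move: (tval (slots M)) (size_slots M) wM nzM => s ss ws nzs.
have [v vs nv] : exists2 v, v \in s & v != 0%MM.
  apply/hasP; apply: contraNT nb; rewrite -all_predC => /allP H.
  rewrite -ws /wt big_seq big1 // => v /H /=; rewrite negbK => /eqP //.
(* If [v] is the only nonzero vector in [s], the orbit sum is an element [gam]. *)
have [/allP H|] := boolP (all (fun x => (x == 0%MM) || (x == v)) s).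
  pose k := count_mem v s.
  have kn : (k <= n)%N by rewrite -ss count_size.
  have pe : perm_eq s (nseq k v ++ nseq (n - k) 0%MM).
    apply: perm_eq_nz => [|x nx].
      by rewrite size_cat !size_nseq subnKC.
    rewrite count_cat !count_nseq /= [0%MM == x]eq_sym (negbTE nx) addn0.
    case: (eqVneq v x) => [<-|nvx]; first by rewrite mul1n.
    apply/eqP; rewrite mul0n -leqn0 leqNgt -has_count has_pred1.
    by apply/negP => /H; rewrite (negbTE nx) eq_sym (negbTE nvx).
  have bE : (v *+ k)%MM = b.
    rewrite -ws (perm_wt pe); apply/mnmP => i; rewrite wtE mulmnE big_cat /=.
    by rewrite !big_nseq !iter_addn_0 mnm0E mul0n addn0.
  rewrite (orb_perm pe) -gam_orb // -bE; apply: decomp_gam.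
  by rewrite bE.
rewrite -has_predC => /hasP[w wsn]; rewrite /= negb_or => /andP[nw wv].
have sp1 : size (part1 v s) = n by rewrite size_map.
have sp2 : size (part2 v s) = n by rewrite size_map.
have wparts : (wt (part1 v s) + wt (part2 v s))%MM = b.
  by rewrite -wt_zipadd // zipadd_parts.
have pos t x : x \in t -> x != 0%MM -> (0 < mdeg (wt t))%N.
  move=> xt nx; rewrite mdeg_wt (big_rem x) //= addn_gt0.
  by rewrite [(0 < mdeg x)%N]lt0n mdeg_eq0 nx.
have w1 : (0 < mdeg (wt (part1 v s)))%N.
  apply: (pos _ v) => //; apply/mapP; exists v => //; by rewrite eqxx.
have w2 : (0 < mdeg (wt (part2 v s)))%N.
  by apply: (pos _ w) => //; apply/mapP; exists w => //; rewrite (negbTE wv).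
have wdeg : mdeg b = (mdeg (wt (part1 v s)) + mdeg (wt (part2 v s)))%N.
  by rewrite -wparts mdegD.
have := orb_parts ss nv; set rest := \sum_(q <- _ | _) _ => E.
have rest_supp M' : M' \in msupp rest ->
    wt (slots M') = b /\ (nz (slots M') < L)%N.
  move/msupp_sum_le/flattenP => [u /mapP[[t1 t2]]].
  rewrite mem_filter /= => /andP[D /allpairsP[[u1 u2] /= [u1p u2p [E1 E2]]]].
  subst u1 u2; rewrite !mem_permutations in u1p u2p => ->.
  rewrite msuppX inE => /eqP ->.
  have st1 : size t1 = n by rewrite (perm_size u1p).
  have st2 : size t2 = n by rewrite (perm_size u2p).
  rewrite slots_mon ?size_zipadd // wt_zipadd // (perm_wt u1p) (perm_wt u2p).
  split=> //; apply: leq_trans (nz_zipadd st1 st2 D) _.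
  rewrite (perm_nz u1p) (perm_nz u2p) -ltnS; apply: leq_trans nzs.
  rewrite ltnS /nz !count_nth ?sp1 ?sp2 // -big_split /=; apply: leq_sum => j _.
  rewrite nth_part1 // nth_part2; case: (nth 0%MM s j =P v) => [->|_]; rewrite /= eqxx ?addn0 ?nv //.
rewrite E -scaleN1r; apply: decompD; last first.
  apply: decompZ; apply: IH.
  - by move=> M' /rest_supp[].
  - have -> : rest = orb A n (part1 v s) * orb A n (part2 v s) - orb A n s.
      by rewrite E opprB addrC subrK.
    by apply: TS_B; [apply: TS_M|]; apply: TS_orb.
  - by move=> M' /rest_supp[].
by apply: decomp_low; apply: ga_mul; apply: low_orb => //; rewrite wdeg; lia.
Qed.

End Indecomposables.

(** * The diagonal functional *)

Section Counting.
Variable r : nat.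
Implicit Types (s t u : seq 'X_{1..r}) (v x : 'X_{1..r}).

Lemma sum_count s u (F : 'X_{1..r} -> nat) : uniq u -> {subset s <= u} ->
  (\sum_(x <- s) F x = \sum_(v <- u) count_mem v s * F v)%N.
Proof.
move=> uu; elim: s => [|x s IH] su.
  by rewrite big_nil big1 // => v _; rewrite mul0n.
rewrite big_cons IH; last by move=> y ys; apply: su; rewrite inE ys orbT.
rewrite [RHS](eq_bigr (fun v => (x == v) * F v + count_mem v s * F v)%N); last first.
  by move=> v _; rewrite /= mulnDl.
rewrite big_split /=; congr (_ + _)%N.
rewrite (bigD1_seq x) //= ?su ?mem_head // eqxx mul1n big1 ?addn0 // => v nv.
by rewrite eq_sym (negbTE nv).
Qed.

(** The multinomial coefficient, by recursion on the first entry, whose removal lowers one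
    multiplicity by one. *)
Lemma size_permutations_count s u : uniq u -> {subset s <= u} ->
  (size (permutations s) * \prod_(v <- u) (count_mem v s)`! = (size s)`!)%N.
Proof.
move=> uu; have [m] := ubnP (size s); elim: m s => // m IH s lt su.
have [s0|spos] := posnP (size s).
  by rewrite (size0nil s0) /= big1.
rewrite (perm_size (permutationsE spos)) size_allpairs_dep sumnE big_map.
rewrite big_distrl /=.
have E x : x \in undup s ->
    (size (permutations (rem x s)) * \prod_(v <- u) (count_mem v s)`!
     = count_mem x s * (size s).-1`!)%N.
  rewrite mem_undup => xs.
  have szr := size_rem xs.
  rewrite -szr -(IH (rem x s)); first last.
  - by move=> y /mem_rem /su.
  - by rewrite szr prednK.
  rewrite mulnCA; congr (_ * _)%N.
  rewrite !(bigD1_seq x) ?su //= mulnA; congr (_ * _)%N.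
    have xp : (0 < count_mem x s)%N by rewrite -has_count has_pred1.
    by rewrite count_rem xs /= eqxx subn1 -{1 2}(prednK xp) factS.
  apply: eq_bigr => v nv; congr (_ `!); rewrite count_rem /=.
  by rewrite eq_sym (negbTE nv) andbF subn0.
rewrite (eq_big_seq _ E) -big_distrl /=.
have -> : (\sum_(x <- undup s) count_mem x s = size s)%N.
  rewrite -sum1_size (sum_count (fun _ => 1%N) (undup_uniq s)).
    by apply: eq_bigr => v _; rewrite muln1.
  by move=> x; rewrite mem_undup.
by rewrite -{1}(prednK spos) -factS prednK.
Qed.

Variables (n : nat) (i0 : 'I_r) (j0 : 'I_n).

(** The value of the functional [fnl] on the orbit sum of [s], taken at the multidegree of [s]. *)
Definition tau s : nat := (\sum_(t <- permutations s) nth 0%MM t j0 i0)%N.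

(** Rotations permute the arrangements, so every slot contributes the same total; over all slots
    each arrangement contributes its weight. *)
Lemma tau_eq s : size s = n -> (n * tau s = wt s i0 * size (permutations s))%N.
Proof.
move=> ss.
have rotE (j : 'I_n) : tau s = (\sum_(t <- permutations s) nth 0%MM t j i0)%N.
  have pe k : perm_eq [seq rot k t | t <- permutations s] (permutations s).
    apply: uniq_perm; rewrite ?permutations_uniq //.
      by rewrite map_inj_uniq ?permutations_uniq //; apply: rot_inj.
    move=> t; rewrite mem_permutations; apply/mapP/idP => [[t' t'p ->]|tp].
      by rewrite perm_rot -mem_permutations.
    exists (rotr k t); last by rewrite rotrK.
    by rewrite mem_permutations perm_rotr.
  have hd t : t \in permutations s -> nth 0%MM t j = nth 0%MM (rot j t) 0.
    rewrite mem_permutations => /perm_size; rewrite ss => st.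
    by rewrite /rot nth_cat size_drop st subn_gt0 ltn_ord nth_drop addn0.
  have hd0 t : t \in permutations s -> nth 0%MM t j0 = nth 0%MM (rot j0 t) 0.
    rewrite mem_permutations => /perm_size; rewrite ss => st.
    by rewrite /rot nth_cat size_drop st subn_gt0 ltn_ord nth_drop addn0.
  rewrite /tau (eq_big_seq _ (fun t tp => congr1 (fun v : 'X_{1..r} => v i0) (hd0 t tp))).
  rewrite [RHS](eq_big_seq _ (fun t tp => congr1 (fun v : 'X_{1..r} => v i0) (hd t tp))).
  rewrite -(big_map (rot j0) xpredT (fun t => nth 0%MM t 0 i0)) (perm_big _ (pe j0)).
  by rewrite -[RHS](big_map (rot j) xpredT (fun t => nth 0%MM t 0 i0)) (perm_big _ (pe j)).
rewrite -[X in (X * _)%N]card_ord -sum_nat_const.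
rewrite (eq_bigr _ (fun j _ => rotE j)) exchange_big /=.
rewrite (eq_big_seq (fun _ => wt s i0)); last first.
  move=> t; rewrite mem_permutations => ts.
  rewrite -(perm_wt ts) wtE (big_nth 0%MM) (perm_size ts) ss big_mkord //.
by rewrite big_const_seq count_predT iter_addn_0.
Qed.

End Counting.

Section Functional.
Variables (A : comNzRingType) (r n : nat) (i0 : 'I_r) (j0 : 'I_n).
Implicit Types (f g h : {mpoly A[r * n]}) (s t : seq 'X_{1..r}) (v b x : 'X_{1..r}).

Definition diag f : {mpoly A[r]} := f \mPo [tuple 'X_(pair_of k).1 | k < r * n].

Lemma diagX M : diag 'X_[M] = 'X_[wt (slots M)].
Proof.
rewrite /diag comp_mpolyX (big_var_idx _ (fun k => tnth _ k ^+ M k)) /=.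
rewrite wt_slots -mprodXE; apply: eq_bigr => j _.
rewrite mpolyXE_id; apply: eq_bigr => i _.
by rewrite tnth_mktuple pair_of_var_idx mnmE.
Qed.

(* The derivation over [diag] given by the Euler operator of the variable
   [x_(i0,j0)]. *)
Definition diagD f : {mpoly A[r]} :=
  diag ('X_(var_idx i0 j0) * f^`M(var_idx i0 j0)).

Lemma diagDX M : diagD 'X_[M] = (slot M j0 i0)%:R *: 'X_[wt (slots M)].
Proof.
rewrite /diagD mderivX -scalerAr /diag comp_mpolyZ mnmE.
have [->|Mk] := posnP (M (var_idx i0 j0)); first by rewrite !scale0r.
by rewrite -mpolyXD addmC submK ?lep1mP -?lt0n // -diagX.
Qed.

Lemma diagDD f g : diagD (f + g) = diagD f + diagD g.
Proof. by rewrite /diagD mderivD mulrDr /diag rmorphD. Qed.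

Lemma diagDZ c f : diagD (c *: f) = c *: diagD f.
Proof. by rewrite /diagD mderivZ -scalerAr /diag comp_mpolyZ. Qed.

Lemma diagD0 : diagD 0 = 0.
Proof. by rewrite /diagD mderiv0 mulr0 /diag raddf0. Qed.

Lemma diagD_sum (I : Type) (u : seq I) (P : pred I) F :
  diagD (\sum_(i <- u | P i) F i) = \sum_(i <- u | P i) diagD (F i).
Proof. exact: (big_morph diagD diagDD diagD0). Qed.

Lemma diagD_mul f g : diagD (f * g) = diagD f * diag g + diag f * diagD g.
Proof.
have aux (S : comNzRingType) (x a a' b b' : S) :
  x * (a' * b + a * b') = x * a' * b + a * (x * b') by rewrite mulrDr mulrA mulrCA.
by rewrite /diagD mderivM /diag -!rmorphM -rmorphD aux.
Qed.

Lemma diagDC c : diagD c%:MP = 0.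
Proof. by rewrite /diagD mderivC mulr0 /diag rmorph0. Qed.

Definition fnl b f : A := (diagD f)@_b.

Lemma fnlD b f g : fnl b (f + g) = fnl b f + fnl b g.
Proof. by rewrite /fnl diagDD mcoeffD. Qed.

Lemma fnlZ b c f : fnl b (c *: f) = c * fnl b f.
Proof. by rewrite /fnl diagDZ mcoeffZ. Qed.

Lemma fnl_orb b s : size s = n ->
  fnl b (orb A n s) = (wt s == b)%:R * (tau i0 j0 s)%:R.
Proof.
move=> ss; rewrite /fnl /orb diagD_sum raddf_sum /= natr_sum mulr_sumr.
apply: eq_big_seq => t; rewrite mem_permutations => ts.
have st : size t = n by rewrite (perm_size ts).
rewrite diagDX mcoeffZ mcoeffX slots_mon // (perm_wt ts) slot_mon mulrC.
by [].
Qed.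

Lemma diag_orb b s : size s = n ->
  (diag (orb A n s))@_b = (wt s == b)%:R * (size (permutations s))%:R.
Proof.
move=> ss; rewrite /orb /diag [X in X@__]raddf_sum raddf_sum /=.
rewrite -[X in _ * X%:R]sum1_size natr_sum mulr_sumr.
apply: eq_big_seq => t; rewrite mem_permutations => ts.
have st : size t = n by rewrite (perm_size ts).
by rewrite -/(diag _) diagX mcoeffX slots_mon // (perm_wt ts) mulr1.
Qed.

(** Slot [j0] carries [v] exactly for the sets containing [j0], which are counted by Pascal's rule
    as all sets minus those avoiding [j0]. *)
Lemma fnl_gam b k v : (0 < k)%N ->
  fnl b (gam A n k v) = (v *+ k == b)%MM%:R * (v i0 * 'C(n.-1, k.-1))%:R.
Proof.
move=> k0; rewrite gamE /fnl diagD_sum raddf_sum /=.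
rewrite (eq_bigr (fun S : {set 'I_n} => (v *+ k == b)%MM%:R * ((j0 \in S) * v i0)%:R));
  last first.
  move=> S /eqP Sk; rewrite diagDX mcoeffZ mcoeffX wt_setmon Sk mulrC.
  by rewrite slot_setmon; case: ifP => _; rewrite ?mul1n ?mnm0E ?mul0n.
rewrite -mulr_sumr -natr_sum -big_distrl /= mulnC; congr (_ * (_ * _)%:R).
have n0 : (0 < n)%N by apply: leq_ltn_trans (ltn_ord j0).
have := card_draws 'I_n k; rewrite card_ord -sum1dep_card (bigID (fun S : {set 'I_n} => j0 \in S)) /=.
have -> : (\sum_(S : {set 'I_n} | (#|S| == k) && (j0 \notin S)) 1 = 'C(n.-1, k))%N.
  have := cards_draws [set~ j0] k; rewrite cardsC1 card_ord => <-.
  rewrite -sum1dep_card; apply: eq_bigl => S; rewrite andbC.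
  congr (_ && _); apply/idP/subsetP => [jS x xS|H].
    by rewrite !inE; apply: contraNneq jS => <-.
  by apply/negP => /H; rewrite !inE eqxx.
have -> : 'C(n, k) = ('C(n.-1, k.-1) + 'C(n.-1, k))%N.
  by rewrite -{1}(prednK n0) -{1}(prednK k0) binS prednK // addnC.
move/addIn <-; rewrite [RHS]big_mkcondr /=.
by apply: eq_bigr => S _; case: (_ \in _).
Qed.

End Functional.

Section Divisibility.
Variables (A : comNzRingType) (p : nat).
Implicit Types (x y : A).

Definition dvdA x : Prop := exists y, x = p%:R * y.

Lemma dvdA0 : dvdA 0. Proof. by exists 0; rewrite mulr0. Qed.

Lemma dvdAD x y : dvdA x -> dvdA y -> dvdA (x + y).
Proof. by move=> [a ->] [b ->]; exists (a + b); rewrite mulrDr. Qed.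

Lemma dvdAM x y : dvdA y -> dvdA (x * y).
Proof. by move=> [a ->]; exists (x * a); rewrite mulrCA. Qed.

Lemma dvdAMr x y : dvdA x -> dvdA (x * y).
Proof. by rewrite mulrC; apply: dvdAM. Qed.

Lemma dvdA_sum (I : Type) (u : seq I) (P : pred I) F :
  (forall i, P i -> dvdA (F i)) -> dvdA (\sum_(i <- u | P i) F i).
Proof.
by move=> H; elim/big_rec: _ => [|i x Pi dx]; [apply: dvdA0|apply: dvdAD; auto].
Qed.

Lemma dvdA_nat m : (p %| m)%N -> dvdA m%:R.
Proof. by case/dvdnP => q ->; exists q%:R; rewrite natrM mulrC. Qed.

End Divisibility.

Section FunctionalModP.
Variables (A : comNzRingType) (r n p K : nat) (i0 : 'I_r) (j0 : 'I_n).
Hypothesis pp : prime p.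
Hypothesis nK : n = (p ^ K)%N.
Implicit Types (f g h : {mpoly A[r * n]}) (s t : seq 'X_{1..r}) (v b x : 'X_{1..r}).

(** By [tau_eq], [p ^ K] divides [b i] times the size of the orbit. As [0 < b i < p ^ K] for some
    [i], that size is a multiple of [p]. *)
Lemma diag_dvd b f : TS f -> b != 0%MM -> (mdeg b < n)%N -> dvdA p (diag f)@_b.
Proof.
move=> Tf nb bn; apply: (TS_ind (P := fun f => dvdA p (diag f)@_b)) Tf _ _ _.
- by rewrite /diag raddf0 mcoeff0; apply: dvdA0.
- by move=> g h pg ph; rewrite /diag raddfD mcoeffD; apply: dvdAD.
move=> M _; rewrite /diag comp_mpolyZ mcoeffZ; apply: dvdAM.
rewrite -/(diag _) diag_orb ?size_slots //; case: eqP => [wb|_]; last first.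
  by rewrite mul0r; apply: dvdA0.
rewrite mul1r; apply: dvdA_nat.
have [i bi] : exists i, b i != 0%N.
  apply/existsP; apply: contraR nb; rewrite negb_exists => /forallP H.
  by apply/eqP/mnmP => i; rewrite mnm0E; apply/eqP; have := H i; rewrite negbK.
have := tau_eq i j0 (size_slots M); rewrite wb => E.
apply: contraT => ndv.
have : (p ^ K %| b i * size (permutations (slots M)))%N by rewrite -E -nK dvdn_mulr.
rewrite Gauss_dvdl; last by rewrite coprimeXl // prime_coprime.
move/dvdn_leq; rewrite lt0n => /(_ bi); rewrite -nK leqNgt.
by rewrite (leq_ltn_trans _ bn) // mdegE (bigD1 i) //= leq_addr.
Qed.

(* A product of two elements without constant term is killed modulo [p]. *)
Lemma fnl_gen b (X : {mpoly A[r * n]} -> Prop) f : (mdeg b < n)%N ->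
  (forall g, X g -> TS g /\ dvdA p (fnl i0 j0 b g)) -> gen_alg X f ->
  TS f /\ dvdA p (fnl i0 j0 b f).
Proof.
move=> bn HX; elim=> [g|c|g h _ [Tg dg] _ [Th dh]|g h _ [Tg dg] _ [Th dh]].
- exact: HX.
- split; first exact: TS_C.
  by rewrite /fnl diagDC mcoeff0; apply: dvdA0.
- by split; [apply: TS_D|rewrite fnlD; apply: dvdAD].
split; first exact: TS_M.
(* A splitting of [b] either leaves all of [b] to the differentiated factor, where the hypothesis
   applies, or a nonzero part to the other factor, where [diag_dvd] applies. *)
have half g1 h1 : TS h1 -> dvdA p (fnl i0 j0 b g1) ->
    dvdA p (diagD i0 j0 g1 * diag h1)@_b.
  move=> Th1 dg1; rewrite mcoeffM; apply: dvdA_sum => -[[k1 ?] [k2 ?]] /= /eqP bE.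
  have [k20|k20] := eqVneq k2 0%MM.
    have -> : k1 = b by rewrite bE k20 addm0.
    exact: dvdAMr.
  apply/dvdAM/diag_dvd => //.
  by apply: leq_ltn_trans bn; rewrite bE mdegD leq_addl.
rewrite /fnl diagD_mul mcoeffD; apply: dvdAD; first exact: half.
by rewrite mulrC; apply: half.
Qed.

(** Adjacent entries of row [n.-1] add up to an inner entry of row [p ^ K], a multiple of [p];
    nondivisibility therefore propagates from the entry [1] at [k = 0]. *)
Lemma bin_ndvd k : (k < n)%N -> ~~ (p %| 'C(n.-1, k))%N.
Proof.
have n0 : (0 < n)%N by rewrite nK expn_gt0 prime_gt0.
elim: k => [_|k IH kn]; first by rewrite bin0 dvdn1 neq_ltn prime_gt1 ?orbT.
have dv : (p %| 'C(n, k.+1))%N.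
  have E := mul_bin_diag n k.
  apply: contraT => ndv.
  have : (p ^ K %| k.+1 * 'C(n, k.+1))%N by rewrite -E -nK dvdn_mulr.
  rewrite Gauss_dvdl; last by rewrite coprimeXl // prime_coprime.
  by move/(dvdn_leq (ltn0Sn k)); rewrite -nK leqNgt kn.
move: dv; rewrite -{1}(prednK n0) binS => dv.
by apply: contra (IH (ltnW kn)) => d1; rewrite dvdn_addr in dv.
Qed.

End FunctionalModP.

(** * Changing the number of slots *)

Section Projection.
Variables (R A : comNzRingType) (rho : {rmorphism R -> A}) (r n d : nat).
Hypothesis dn : (d <= n)%N.
Implicit Types (f g : {mpoly R[r * n]}) (M : 'X_{1..r * n}) (v : 'X_{1..r}).

Lemma slots_ext (t : seq 'X_{1..r}) : (size t <= n)%N ->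
  slots (mon n t) = t ++ nseq (n - size t) 0%MM :> seq _.
Proof.
move=> tn; apply: (@eq_from_nth _ 0%MM).
  by rewrite size_slots size_cat size_nseq subnKC.
move=> j; rewrite size_slots => jn.
rewrite (nth_slots _ (Ordinal jn)) slot_mon nth_cat /=.
by case: ltnP => // tj; rewrite nth_default // nth_nseq if_same.
Qed.

Definition proj_var (k : 'I_(r * n)) : {mpoly A[r * d]} :=
  if insub (nat_of_ord (pair_of k).2) : option 'I_d is Some j
  then 'X_(var_idx (pair_of k).1 j) else 0.

(** Restriction to the first [d] slots together with a change of coefficients: [rho] comes from the
    integers in the proof of generation and is the identity in the proof of minimality. *)
Definition proj f : {mpoly A[r * d]} := mmap (@mpolyC (r * d) A \o rho) proj_var f.

Lemma projD f g : proj (f + g) = proj f + proj g.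
Proof. exact: mmapD. Qed.

Lemma projB f g : proj (f - g) = proj f - proj g.
Proof. exact: mmapB. Qed.

Lemma projM f g : proj (f * g) = proj f * proj g.
Proof. exact: rmorphM. Qed.

Lemma projC c : proj c%:MP = (rho c)%:MP.
Proof. exact: mmapC. Qed.

Lemma projZ c f : proj (c *: f) = rho c *: proj f.
Proof. by rewrite -mul_mpolyC projM projC mul_mpolyC. Qed.

Lemma projX M : proj 'X_[M] =
  if [forall j : 'I_n, (d <= j)%N ==> (slot M j == 0%MM)]
  then 'X_[mon d (slots M)] else 0.
Proof.
rewrite /proj mmapX /mmap1 (big_var_idx _ (fun k => proj_var k ^+ M k)) /=.
have pv i (j : 'I_n) : proj_var (var_idx i j) =
    if insub (val j) : option 'I_d is Some j' then 'X_(var_idx i j') else 0.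
  by rewrite /proj_var pair_of_var_idx.
pose H (j : nat) : {mpoly A[r * d]} :=
  if insub j : option 'I_d is Some j'
  then \prod_(i < r) 'X_(var_idx i j') ^+ (nth 0%MM (slots M) j) i
  else (nth 0%MM (slots M) j == 0%MM)%:R.
rewrite (eq_bigr (fun j : 'I_n => H j)); last first.
  move=> j _; rewrite /H nth_slots.
  under eq_bigr => i _ do rewrite pv.
  case: insubP => [j' _ jj'|_].
    by apply: eq_bigr => i _; rewrite mnmE.
  case: eqP => [M0|M0].
    rewrite big1 // => i _; have := congr1 (fun w : 'X_{1..r} => w i) M0.
    by rewrite /slot mnmE mnm0E => ->; rewrite expr0.
  have [i Mi] : exists i, M (var_idx i j) != 0%N.
    apply/existsP; apply: contra_notT M0; rewrite negb_exists => /forallP E.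
    by apply/mnmP => i; rewrite mnm0E mnmE; apply/eqP; have := E i; rewrite negbK.
  by rewrite (bigD1 i) //= expr0n (negbTE Mi) mul0r.
case: forallP => [all0|not0]; last first.
  have [j jd M0] : exists2 j : 'I_n, (d <= j)%N & slot M j != 0%MM.
    apply/exists_inP; apply: contra_notT not0; rewrite negb_exists => /forallP E j.
    by have := E j; rewrite negb_and negbK implybE.
  rewrite (bigD1 j) //= /H nth_slots insubF ?(negbTE M0) ?mul0r //.
  by rewrite ltnNge jd.
rewrite mpolyXE_id (big_var_idx _ (fun k => 'X_k ^+ mon d (slots M) k)) /=.
rewrite (eq_bigr (fun j : 'I_d => H j)); last first.
  move=> j _; rewrite /H valK; apply: eq_bigr => i _.
  by rewrite mnmE pair_of_var_idx.
rewrite (big_ord_widen n H dn) [RHS]big_mkcond /=; apply: eq_bigr => j _.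
case: ltnP => // dj; rewrite /H insubF; last by rewrite ltnNge dj.
by rewrite nth_slots; have := all0 j; rewrite dj /= => ->.
Qed.

Lemma mcoeff_proj f (M : 'X_{1..r * d}) : (proj f)@_M = rho f@_(mon n (slots M)).
Proof.
have sM : (size (slots M) <= n)%N by rewrite size_slots.
rewrite {1}[f]mpolyE /proj [X in X@__]raddf_sum raddf_sum /=.
rewrite (eq_bigr (fun M' => rho f@_M' * (mon n (slots M) == M')%:R)); last first.
  move=> M' _; rewrite -/(proj _) projZ projX mcoeffZ; congr (_ * _).
  case: forallP => [H|H]; last first.
    rewrite mcoeff0; case: eqP => // ME; case: H => j; apply/implyP => dj.
    by rewrite -ME slot_mon nth_default // size_slots.
  rewrite mcoeffX; congr ((_ : bool)%:R); apply/eqP/eqP => [<-|<-].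
    apply: slot_eq => j; rewrite slot_mon.
    have [jd|dj] := ltnP j d.
      by rewrite (nth_slots _ (Ordinal jd)) slot_mon nth_slots.
    by rewrite nth_default ?size_slots //; apply/esym/eqP/(implyP (H j)).
  apply: slot_eq => j; rewrite slot_mon.
  by rewrite (nth_slots _ (widen_ord dn j)) slot_mon nth_slots.
have [fM|fM] := boolP (mon n (slots M) \in msupp f).
  rewrite (bigD1_seq (mon n (slots M))) ?msupp_uniq //= eqxx mulr1 big1 ?addr0 //.
  by move=> M' ne; rewrite eq_sym (negbTE ne) mulr0.
rewrite (memN_msupp_eq0 fM) rmorph0 big_seq big1 // => M' M'f.
by case: eqP fM => [->|_ _]; rewrite ?M'f // mulr0.
Qed.

Lemma slots_mon_ext (M : 'X_{1..r * d}) :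
  slots (mon n (slots M)) = slots M ++ nseq (n - d) 0%MM :> seq _.
Proof. by rewrite slots_ext size_slots. Qed.

Lemma proj_TS f : TS f -> TS (proj f).
Proof.
move/TS_mcoeffP => Tf; apply/TS_mcoeffP => M M' MM'; rewrite !mcoeff_proj.
by congr (rho _); apply: Tf; rewrite !slots_mon_ext perm_cat2r.
Qed.

Lemma wt_ext (M : 'X_{1..r * d}) : wt (slots (mon n (slots M))) = wt (slots M).
Proof.
apply/mnmP => i; rewrite !wtE slots_mon_ext big_cat /=.
by rewrite big_nseq iter_addn_0 mnm0E mul0n addn0.
Qed.

Lemma nz_ext (M : 'X_{1..r * d}) : nz (slots (mon n (slots M))) = nz (slots M).
Proof. by rewrite /nz slots_mon_ext count_cat count_nseq /= eqxx mul0n addn0. Qed.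

Lemma msize_proj f m : (msize f <= m)%N -> (msize (proj f) <= m)%N.
Proof.
move/msize_leP => H; apply/msize_leP => M; rewrite mcoeff_msupp mcoeff_proj => fM.
have := H (mon n (slots M)); rewrite mdeg_slots wt_ext -mdeg_slots; apply.
by rewrite mcoeff_msupp; apply: contraNneq fM => ->; rewrite rmorph0.
Qed.

Lemma nz_slots_le (M : 'X_{1..r * d}) : (nz (slots M) <= d)%N.
Proof. by have := count_size (predC1 0%MM) (slots M); rewrite size_slots. Qed.

Lemma proj_orb_nz s : size s = n -> (d < nz s)%N -> proj (orb R n s) = 0.
Proof.
move=> ss ds; apply/mpolyP => M; rewrite mcoeff_proj mcoeff_orb // mcoeff0.
case: (boolP (perm_eq _ _)) => [/perm_nz|_]; last by rewrite rmorph0.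
by rewrite nz_ext => E; move: ds; rewrite -E ltnNge nz_slots_le.
Qed.

Lemma proj_gam k v : v != 0%MM -> proj (gam R n k v) = gam A d k v.
Proof.
move=> nv; have [nk|kn] := ltnP n k.
  rewrite !gam_gt ?(leq_ltn_trans dn) //; exact: mmap0.
apply/mpolyP => M; rewrite mcoeff_proj gam_orb // mcoeff_orb; last first.
  by rewrite size_cat !size_nseq subnKC.
have [dk|kd] := ltnP d k.
  rewrite gam_gt // mcoeff0; case: (boolP (perm_eq _ _)) => [|_]; last by rewrite rmorph0.
  move/perm_nz; rewrite nz_ext {2}/nz count_cat !count_nseq /= nv eqxx.
  by rewrite mul1n mul0n addn0 => E; move: dk; rewrite -E ltnNge nz_slots_le.
rewrite gam_orb // mcoeff_orb; last by rewrite size_cat !size_nseq subnKC.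
rewrite rmorph_nat slots_mon_ext.
have -> : nseq (n - k) (0%MM : 'X_{1..r}) = nseq (d - k) 0%MM ++ nseq (n - d) 0%MM.
  by rewrite -nseqD; congr nseq; lia.
by rewrite catA perm_cat2r.
Qed.

(** By symmetry a monomial with at most [d] nonzero slots may be rearranged so that these come
    first; its coefficient is then visible in the projection. *)
Lemma proj_eq0_nz f M : injective rho -> TS f -> proj f = 0 ->
  M \in msupp f -> (d < nz (slots M))%N.
Proof.
move=> inj /TS_mcoeffP Tf pf; rewrite mcoeff_msupp ltnNge; apply: contra => le.
pose t := [seq x <- slots M | x != 0%MM] ++ nseq (d - nz (slots M)) 0%MM.
have st : size t = d by rewrite size_cat size_nseq size_filter subnKC.
have pe : perm_eq (slots M) (slots (mon n (slots (mon d t)))).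
  apply: perm_eq_nz => [|x nx]; first by rewrite !size_slots.
  rewrite slots_mon_ext slots_mon // !count_cat !count_nseq /=.
  rewrite [0%MM == x]eq_sym (negbTE nx) !mul0n !addn0 count_filter.
  apply: eq_count => y /=; case: (y =P x) => // ->; exact/esym.
rewrite (Tf _ _ pe); apply/eqP/inj; rewrite -mcoeff_proj pf mcoeff0 rmorph0 //.
Qed.

End Projection.

(** * Orbit sums with many nonzero slots *)

Section OrbitCounts.
Variables (r n p K : nat) (i0 : 'I_r) (j0 : 'I_n).
Hypothesis pp : prime p.
Hypothesis nK : n = (p ^ K)%N.
Implicit Types (s : seq 'X_{1..r}) (v b x : 'X_{1..r}).

Let p1 : (1 < p)%N := prime_gt1 pp.

Lemma nz_count s u : uniq u -> {subset s <= u} ->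
  nz s = (\sum_(v <- u | v != 0%MM) count_mem v s)%N.
Proof.
move=> uu su; rewrite /nz -sum1_count big_mkcond /= (sum_count _ uu su).
by rewrite [RHS]big_mkcond /=; apply: eq_bigr => v _; case: ifP; rewrite ?muln1 ?muln0.
Qed.

(** [mult_qv_gt] compares [d] with the multiplicities of the nonzero vectors. Each of these vectors
    has a positive coordinate, so monotonicity and superadditivity pass from multiplicities to the
    coordinates of the weight. *)
Lemma tau_qv s d m : size s = n -> (0 < wt s i0)%N -> (d < nz s)%N ->
  ~~ (p %| tau i0 j0 s)%N -> (p <= m)%N ->
  (qv p m d < \sum_(i < r) qv p m (wt s i))%N.
Proof.
move=> ss b0 ds nd pm; pose u := undup (0%MM :: s).
have uu : uniq u := undup_uniq _.
have su : {subset s <= u} by move=> x xs; rewrite mem_undup inE xs orbT.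
have zu : 0%MM \in u by rewrite mem_undup mem_head.
have sm : (\sum_(v <- u) count_mem v s = p ^ K)%N.
  rewrite -nK -ss -sum1_size (sum_count _ uu su).
  by apply: eq_bigr => v _; rewrite muln1.
have cE := size_permutations_count uu su.
rewrite ss nK in cE.
have bE i : wt s i = (\sum_(v <- u) count_mem v s * v i)%N.
  by rewrite wtE (sum_count (fun v : 'X_{1..r} => v i) uu su).
have tE := tau_eq i0 j0 ss; rewrite {1}nK in tE.
rewrite (nz_count uu su) in ds.
have z0 : (0%MM : 'X_{1..r}) i0 = 0%N by rewrite mnm0E.
have := mult_qv_gt pp uu sm cE (bE i0) b0 tE zu z0 nd pm ds.
move/leq_trans; apply.
apply: leq_trans (_ : \sum_(i < r) \sum_(v <- u) qv p m (count_mem v s * v i) <= _)%N.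
  rewrite exchange_big /= big_mkcond /=; apply: leq_sum => v _; case: ifP => // nv.
  have [i vi] : exists i, v i != 0%N.
    apply/existsP; apply: contraT; rewrite negb_exists => /forallP H.
    by case/eqP: nv; apply/mnmP => i; rewrite mnm0E; apply/eqP; have := H i; rewrite negbK.
  rewrite (bigD1 i) //= (leq_trans _ (leq_addr _ _)) //; apply: qv_mono => //.
  by rewrite leq_pmulr // lt0n.
by apply: leq_sum => i _; rewrite bE; apply: qv_sum.
Qed.

Lemma modn_sum_le (I : Type) (u : seq I) (P : pred I) F q :
  ((\sum_(i <- u | P i) F i) %% q <= \sum_(i <- u | P i) F i %% q)%N.
Proof.
elim/big_rec2: _ => [|i x y _ le]; first by rewrite mod0n.
rewrite -modnDm; apply: leq_trans (leq_mod _ _) _.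
by rewrite leq_add2l (leq_trans le).
Qed.

Lemma sum_delta (u : seq 'X_{1..r}) (P : pred 'X_{1..r}) (w : 'X_{1..r}) a : uniq u ->
  (\sum_(v <- u | P v) a * (w == v) <= a)%N.
Proof.
move=> uu; apply: leq_trans (_ : \sum_(v <- u) a * (w == v) <= _)%N.
  rewrite big_mkcond /=; apply: leq_sum => v _; by case: ifP.
rewrite -big_distrr /= -[X in (_ <= X)%N]muln1 leq_mul2l; apply/orP; right.
have [wu|wu] := boolP (w \in u).
  rewrite (bigD1_seq w) //= eqxx big1 // => v nv.
  by rewrite eq_sym (negbTE nv).
rewrite big_seq big1 // => v vu; case: eqP wu => // ->; by rewrite vu.
Qed.

(** The witness consists of [q = p ^ logn p (b i0)] copies of one vector [v'], [m i] copies of each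
    unit vector and zeros. All multiplicities are multiples of [q], with remainders small enough for
    [mult_ndvd]. *)
Lemma tau_exists b d J : b != 0%MM ->
  (mdeg b <= n)%N -> (0 < b i0)%N ->
  (forall i, p ^ logn p (b i0) %| b i)%N ->
  (dig p d J < \sum_i dig p (b i) J)%N ->
  (forall k, (J < k)%N -> \sum_i dig p (b i) k = dig p d k)%N ->
  exists s, [/\ size s = n, wt s = b, (d < nz s)%N & ~~ (p %| tau i0 j0 s)%N].
Proof.
move=> nb bn b0 qb dJ dk.
have [B [j [Bb PB dB Bk]]] := digit_split p1 dJ dk.
set e := logn p (b i0) in qb; set q := (p ^ e)%N in qb; set P := (p ^ J)%N in Bb PB dB Bk.
have q0 : (0 < q)%N by rewrite expn_gt0 prime_gt0.
have P0 : (0 < P)%N by rewrite expn_gt0 prime_gt0.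
(* The digits of every [b i] below place [e] vanish, but some digit at place [J] is positive. *)
have eJ : (e <= J)%N.
  rewrite leqNgt; apply/negP => Je; move: dJ; rewrite big1 ?ltn0 // => i _.
  have /dvdnP[y ->] : (p ^ J.+1 %| b i)%N by apply: dvdn_trans (qb i); apply: dvdn_exp2l.
  by rewrite /dig expnS mulnA mulnK // modnMl.
have qP : (q %| P)%N by apply: dvdn_exp2l.
have qleP : (q <= P)%N by apply: dvdn_leq.
(* Of the spare unit [P] at [j], the part [P - q] goes to the unit vector and [q] is left for [v'].
   The number of nonzero slots becomes the sum of the [B i] plus [P], which exceeds [d]. *)
pose m i := (B i + (i == j) * (P - q))%N.
have mb i : (m i + (i == j) * q <= b i)%N.
  by rewrite /m -addnA -mulnDr subnK.
have qm i : (q %| m i)%N.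
  apply: dvdn_add; first exact: dvdn_trans qP (PB i).
  by apply/dvdn_mull/dvdn_sub.
pose v' := divm [multinom (b i - m i)%N | i < r] q.
have v'E i : (v' i * q + m i = b i)%N.
  rewrite mnmE mnmE divnK ?subnK //; last by rewrite dvdn_sub.
  by apply: leq_trans (mb i); apply: leq_addr.
have v'0 : v' != 0%MM.
  apply/eqP => v0; have := mb j; rewrite eqxx mul1n -(v'E j) v0 mnm0E mul0n add0n.
  by rewrite -[X in (_ <= X)%N]addn0 leq_add2l leqNgt q0.
pose l := (q + \sum_i m i)%N.
have lE : l = (\sum_i B i + P)%N.
  rewrite /l /m big_split /= -big_distrl /= -(big_mkcond (pred1 j) (fun _ => 1%N)) /=.
  by rewrite big_pred1_eq mul1n addnCA subnKC.
have dl : (d < l)%N by rewrite lE.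
have ln : (l <= n)%N.
  apply: leq_trans bn; rewrite mdegE /l addnC.
  have <- : (\sum_i (m i + (i == j) * q) = \sum_i m i + q)%N.
    rewrite [LHS]big_split /= -[X in (_ + X)%N]big_distrl /=.
    by rewrite -(big_mkcond (pred1 j) (fun _ => 1%N)) /= big_pred1_eq mul1n.
  exact: leq_sum.
pose us := flatten [seq nseq (m i) (U_(i) : 'X_{1..r})%MM | i <- enum 'I_r].
pose s := nseq q v' ++ us ++ nseq (n - l) 0%MM.
have sumus (F : 'X_{1..r} -> nat) :
    (\sum_(x <- us) F x = \sum_i m i * F U_(i)%MM)%N.
  rewrite big_flatten big_map big_enum /=; apply: eq_bigr => i _.
  by rewrite big_nseq iter_addn_0 mulnC.
have sums (F : 'X_{1..r} -> nat) :
    (\sum_(x <- s) F x = q * F v' + \sum_i m i * F U_(i)%MM + (n - l) * F 0%MM)%N.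
  by rewrite !big_cat /= sumus !big_nseq !iter_addn_0 addnA ![(F _ * _)%N]mulnC.
have ss : size s = n.
  rewrite -sum1_size sums !muln1 (eq_bigr m) => [|i _]; last by rewrite muln1.
  by rewrite -/l subnKC.
have cs v : v != 0%MM -> count_mem v s = (q * (v' == v) + \sum_i m i * (U_(i)%MM == v))%N.
  move=> nv; rewrite -sum1_count big_mkcond sums /= [0%MM == v]eq_sym (negbTE nv).
  by rewrite muln0 addn0.
have ws : wt s = b.
  apply/mnmP => i; rewrite wtE (sums (fun x : 'X_{1..r} => x i)) mnm0E muln0 addn0 -v'E mulnC.
  congr (_ + _)%N; rewrite (bigD1 i) //= mnm1E eqxx muln1 big1 ?addn0 // => i' ne.
  by rewrite mnm1E (negbTE ne) muln0.
have nzs : nz s = l.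
  rewrite /nz -sum1_count big_mkcond sums /= v'0 eqxx muln1 muln0 addn0 /l.
  by congr (_ + _)%N; apply: eq_bigr => i _; rewrite mnm1_eq0 muln1.
exists s; split=> //; first by rewrite nzs.
pose u := undup (0%MM :: s).
have uu : uniq u := undup_uniq _.
have su : {subset s <= u} by move=> x xs; rewrite mem_undup inE xs orbT.
have zu : 0%MM \in u by rewrite mem_undup mem_head.
have sm : (\sum_(v <- u) count_mem v s = p ^ K)%N.
  rewrite -nK -ss -sum1_size (sum_count _ uu su).
  by apply: eq_bigr => v _; rewrite muln1.
have cE := size_permutations_count uu su.
rewrite ss nK in cE.
have bE : b i0 = (\sum_(v <- u) count_mem v s * v i0)%N.
  by rewrite -ws wtE (sum_count (fun v : 'X_{1..r} => v i0) uu su).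
have tE := tau_eq i0 j0 ss; rewrite {1}nK ws in tE.
have ql : (q %| l)%N by rewrite lE dvdn_add // dvdn_sum // => i _; apply: dvdn_trans qP _.
have qn : (q %| n)%N.
  rewrite nK dvdn_exp2l // -(leq_exp2l _ _ p1) -nK (leq_trans _ ln) // lE.
  by rewrite (leq_trans qleP) // leq_addl.
apply: (mult_ndvd pp uu sm cE bE b0 tE zu).
  move=> v vu; rewrite -/e -/q; have [->|nv] := eqVneq v 0%MM.
    have := sm; rewrite -nK (bigD1_seq 0%MM) //= -(nz_count uu su) nzs => E.
    by rewrite -(dvdn_addl _ ql) E.
  rewrite cs // dvdn_add ?dvdn_mulr // dvdn_sum // => i _.
  exact: dvdn_mulr.
move=> k; rewrite -/e => /andP[ek kK].
have pk0 : (0 < p ^ k)%N by rewrite expn_gt0 prime_gt0.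
(* [v'] may coincide with a unit vector, so the remainders are bounded by those of the separate
   contributions. *)
apply: leq_trans (_ : q %% p ^ k + \sum_i m i %% p ^ k <= _)%N.
  apply: leq_trans (_ : \sum_(v <- u | v != 0%MM)
     (q %% p ^ k * (v' == v) + \sum_i m i %% p ^ k * (U_(i)%MM == v)) <= _)%N.
    apply: leq_sum => v nv; rewrite cs // -modnDm.
    apply: leq_trans (leq_mod _ _) _; apply: leq_add.
      by case: (_ == _); rewrite ?muln1 ?muln0 ?mod0n.
    apply: leq_trans (modn_sum_le _ _ _ _) _; apply: leq_sum => i _.
    by case: (_ == _); rewrite ?muln1 ?muln0 ?mod0n.
  rewrite big_split /=; apply: leq_add; first exact: sum_delta.
  by rewrite exchange_big /=; apply: leq_sum => i _; apply: sum_delta.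
have qk : (q < p ^ k)%N by rewrite ltn_exp2l.
rewrite modn_small //.
have mk : (\sum_i m i %% p ^ k <= \sum_i B i %% p ^ k + (P - q) %% p ^ k)%N.
  apply: leq_trans (_ : \sum_i (B i %% p ^ k + (i == j) * ((P - q) %% p ^ k)) <= _)%N.
    apply: leq_sum => i _; rewrite /m -modnDm; apply: leq_trans (leq_mod _ _) _.
    by rewrite leq_add2l; case: (i == j); rewrite ?mul1n ?mul0n ?mod0n.
  rewrite big_split /= -big_distrl /= -(big_mkcond (pred1 j) (fun _ => 1%N)) /=.
  by rewrite big_pred1_eq mul1n.
apply: leq_trans (leq_add (leqnn q) mk) _.
(* For [k <= J] the [B i] vanish modulo [p ^ k] and [P - q] leaves [p ^ k - q]; for larger [k] the
   bound from [digit_split] applies. *)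
have [kJ|Jk] := leqP k J.
  have kP : (p ^ k %| P)%N by apply: dvdn_exp2l.
  rewrite big1 ?add0n; last by move=> i _; apply/eqP; apply: dvdn_trans kP (PB i).
  have -> : (P - q = (P - p ^ k) + (p ^ k - q))%N.
    by rewrite addnBA ?(ltnW qk) // subnK // dvdn_leq.
  have /dvdnP[y ->] : (p ^ k %| P - p ^ k)%N by apply: dvdn_sub.
  have lt : (p ^ k - q < p ^ k)%N by rewrite ltn_subrL q0 pk0.
  by rewrite modnMDl (modn_small lt) subnKC // ltnW.
have := Bk k Jk; apply: leq_trans.
rewrite addnC -addnA leq_add2l; apply: leq_trans (leq_add (leq_mod _ _) (leqnn q)) _.
by rewrite subnK.
Qed.

End OrbitCounts.

(** * Generation *)

Lemma invertibleM (A : comNzRingType) (x y : A) :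
  invertible x -> invertible y -> invertible (x * y).
Proof. by move=> [x' xx'] [y' yy']; exists (x' * y'); rewrite mulrACA xx' yy' mulr1. Qed.

Lemma invertible_dvd (A : comNzRingType) m p :
  (p %| m)%N -> invertible (m%:R : A) -> invertible (p%:R : A).
Proof. by case/dvdnP => q -> [y]; rewrite natrM mulrC mulrA => E; exists (y * q%:R); rewrite mulrC. Qed.

Section Generation.
Variables (A : comNzRingType) (r d : nat) (G : {mpoly A[r * d]} -> Prop).

(** Descent on a positive [m] with [m%:R *: h] in the algebra: a prime factor invertible in [A] is
    divided out, and for any other one a Bezout relation with an integer prime to it replaces [m] by
    a proper divisor. *)
Lemma ga_int_combination (h : {mpoly A[r * d]}) (c0 : int) :
  c0 != 0 -> gen_alg G (c0%:~R *: h) ->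
  (forall p, inP A p -> exists c : int, ~ dvdA p c /\ gen_alg G (c%:~R *: h)) ->
  gen_alg G h.
Proof.
move=> c00 Jc0 HP.
have [m m0 Jm] : exists2 m : nat, (0 < m)%N & gen_alg G (m%:R *: h).
  case: c0 c00 Jc0 => k k0 Jk; first by exists k; rewrite // lt0n.
  exists k.+1 => //; have -> : k.+1%:R *: h = (-1) *: ((Negz k)%:~R *: h).
    by rewrite scalerA mulN1r NegzE mulrNz opprK.
  exact: ga_scale.
have [M] := ubnP m; elim: M m m0 Jm {c0 c00 Jc0} => // M IH m m0 Jm lt.
have [m1|m1] := leqP m 1.
  by have := Jm; have -> : m = 1%N by [lia]; rewrite scale1r.
have pp := pdiv_prime m1; set p := pdiv m in pp.
have pm : (p %| m)%N := pdiv_dvd m.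
have [[y py]|ninv] := classic (invertible (p%:R : A)).
  apply: (IH (m %/ p)%N).
  - by rewrite divn_gt0 ?prime_gt0 // dvdn_leq.
  - have -> : (m %/ p)%:R *: h = y *: (m%:R *: h).
      by rewrite scalerA -{2}(divnK pm) natrM mulrCA [y * _]mulrC py mulr1.
    exact: ga_scale.
  - by rewrite (leq_trans _ (_ : m <= M)%N) // ltn_Pdiv // prime_gt1.
have [c [cp Jc]] := HP p (conj pp ninv).
have [u [v uv]] := Bezoutz m c.
apply: (IH (gcdn m `|c|)%N).
- by rewrite gcdn_gt0 m0.
- have -> : (gcdn m `|c|)%:R *: h = u%:~R *: (m%:R *: h) + v%:~R *: (c%:~R *: h).
    rewrite !scalerA -scalerDl; congr (_ *: h).
    have := congr1 (fun x : int => x%:~R : A) uv; rewrite rmorphD !rmorphM /= => ->.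
    by [].
  by apply: ga_add; apply: ga_scale.
apply: leq_trans (_ : m <= M)%N => //.
rewrite ltn_neqAle dvdn_leq ?dvdn_gcdl // andbT.
apply/eqP => E; apply: cp.
have : (p %| `|c|)%N by rewrite (dvdn_trans pm) // -E dvdn_gcdr.
by rewrite -[(p %| _)%N]/(p%:Z %| c)%Z => /dvdzP[q ->]; exists q; rewrite mulrC natz.
Qed.

Lemma prim_coef_ndvd (b : 'X_{1..r}) p : b != 0%MM -> prime p ->
  exists i0, ~~ (p %| prim b i0)%N.
Proof.
move=> nb pp; apply/existsP; apply: contraT; rewrite negb_exists => /forallP H.
have : (p %| mgcd (prim b))%N.
  by apply: dvdn_mgcd => i; have := H i; rewrite negbK.
by rewrite mgcd_prim // dvdn1 => /eqP p1; rewrite p1 in pp.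
Qed.

(* An integral relation in [p ^ K] slots, seen through the functional [fnl],
   bounds the coefficient of the indecomposable generator of degree [b]. *)
Lemma ga_multiple (b : 'X_{1..r}) p n (i0 : 'I_r) (j0 : 'I_n) (dn : (d <= n)%N)
    (f : {mpoly int[r * n]}) :
  b != 0%MM -> prime p -> (exists K, n = (p ^ K)%N) -> (mdeg b < n)%N ->
  (forall g : {mpoly A[r * d]}, TS g -> (msize g <= mdeg b)%N -> gen_alg G g) ->
  TS f -> (forall M, M \in msupp f -> wt (slots M) = b) ->
  ~ dvdA p (fnl i0 j0 b f) ->
  gen_alg G (proj (intr : {rmorphism int -> A}) d f) ->
  exists c : int, ~ dvdA p c /\ gen_alg G (c%:~R *: gam A d (mgcd b) (prim b)).
Proof.
move=> nb pp [K nK] bn low Tf wf nf pf.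
have [c Hc] := decomp_TS nb Tf wf.
exists c; split.
  (* If [p] divided [c], then [p] would divide the functional on both summands: the first is
     generated by elements of degree below [mdeg b], which have no part of multidegree [b]. *)
  move=> dc; apply: nf; rewrite -[f](subrK (c *: gam int n (mgcd b) (prim b))).
  rewrite fnlD fnlZ; apply: dvdAD; last exact: dvdAMr.
  apply: (proj2 (fnl_gen (i0 := i0) (j0 := j0) pp nK bn _ Hc)) => g [Tg sg]; split=> //.
  have -> : fnl i0 j0 b g = 0; last exact: dvdA0.
  rewrite [g]mpolyE /fnl diagD_sum raddf_sum big_seq big1 //= => M Mg.
  rewrite diagDZ diagDX mcoeffZ mcoeffZ mcoeffX; case: eqP => [ME|_]; last by rewrite !mulr0.
  by have := msize_mdeg_lt Mg; rewrite mdeg_slots ME ltnNge sg.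
have -> : c%:~R *: gam A d (mgcd b) (prim b) = proj (intr : {rmorphism int -> A}) d f
   - proj (intr : {rmorphism int -> A}) d (f - c *: gam int n (mgcd b) (prim b)).
  rewrite projB projZ proj_gam ?prim_neq0 // opprB addrC subrK //.
apply: ga_sub => //; elim: Hc => [g [Tg sg]|e|g h _ Gg _ Gh|g h _ Gg _ Gh].
- by apply: low; [apply: proj_TS|apply: msize_proj].
- by rewrite projC; apply: ga_const.
- by rewrite projD; apply: ga_add.
- by rewrite projM; apply: ga_mul.
Qed.

End Generation.

(** * The reduced collection generates the symmetric tensors *)

Section Generators.
Variables (A : comNzRingType) (r d : nat) (c : bool).

Let gens := fun g : {mpoly A[r * d]} => exists k a, inCt A d c k a /\ g = gam A d k a.

Lemma P_part n : (0 < n)%N ->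
  exists k m, [/\ n = (k * m)%N, prod_of_P A k & invertible (m%:R : A)].
Proof.
have [M] := ubnP n; elim: M n => // M IH n lt n0.
have [n1|n1] := leqP n 1.
  exists 1%N, 1%N; split; first by lia.
    by exists [::]; split=> //; rewrite big_nil.
  by exists 1; rewrite mulr1.
have pp := pdiv_prime n1; set p := pdiv n in pp.
have pn : (p %| n)%N := pdiv_dvd n.
have np0 : (0 < n %/ p)%N by rewrite divn_gt0 ?prime_gt0 // dvdn_leq.
have np : (n %/ p < M)%N by rewrite (leq_trans _ (_ : n <= M)%N) // ltn_Pdiv // prime_gt1.
have [k [m [E [s [sP kE]] im]]] := IH _ np np0.
have nE : n = (k * m * p)%N by rewrite -E divnK.
have [ip|ninv] := classic (invertible (p%:R : A)).
  exists k, (m * p)%N; split; first by rewrite mulnA.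
    by exists s.
  by rewrite natrM; apply: invertibleM.
exists (p * k)%N, m; split=> //; first by rewrite nE [RHS]mulnC mulnA [(m * p)%N]mulnC; lia.
exists (p :: s); split; last by rewrite big_cons kE.
by move=> q; rewrite inE => /orP[/eqP->|/sP].
Qed.

(** For the first collection [k] is the part of the gcd made of noninvertible primes, for the second
    the whole gcd. A gcd above [d] exceeds the number of slots. *)
Lemma inC_or_gam0 (b : 'X_{1..r}) : b != 0%MM ->
  (exists k a, inC A d c k a /\ (a *+ k)%MM = b) \/
  gam A d (mgcd b) (prim b) = 0.
Proof.
move=> nb; have g0 := mgcd_gt0 nb.
have [dg|gd] := ltnP d (mgcd b); first by right; apply: gam_gt.
left; have [k [m [gE Pk im]]] := P_part g0.
have k0 : (0 < k)%N by move: g0; rewrite gE muln_gt0 => /andP[].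
have m0 : (0 < m)%N by move: g0; rewrite gE muln_gt0 => /andP[].
case Ec: c; last first.
  exists (mgcd b), (prim b); split; last exact: primK.
  by split; [rewrite g0|apply: prim_neq0|apply: mgcd_prim].
have aE : (divm b k *+ k)%MM = b.
  by apply: divmK => i; apply: dvdn_trans (mgcd_dvd b i); rewrite gE dvdn_mulr.
exists k, (divm b k); split=> //; split.
- by rewrite k0 (leq_trans _ gd) // gE leq_pmulr.
- by apply: contraNneq nb => a0; rewrite -aE a0 mulmn_eq0 eqxx.
split=> //; have : (k * mgcd (divm b k) = k * m)%N by rewrite -mgcd_mulmn aE gE.
by move/eqP; rewrite eqn_pmul2l // => /eqP ->.
Qed.

Lemma mgcd_inC k (a : 'X_{1..r}) p : inC A d c k a -> inP A p -> ~~ (p %| mgcd a)%N.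
Proof.
move=> [_ _ H] [pp ninv]; apply/negP => pa; case: c H => [[ia _]|a1].
  exact: ninv (invertible_dvd pa ia).
by move: pa; rewrite a1 dvdn1 => /eqP p1; rewrite p1 in pp.
Qed.

Lemma prime_slots p (b : 'X_{1..r}) : prime p -> (0 < d)%N ->
  exists n K, [/\ n = (p ^ K)%N, (mdeg b < n)%N, (d <= n)%N & (0 < n)%N].
Proof.
move=> pp d0; exists (p ^ (mdeg b + d))%N, (mdeg b + d)%N.
have lt := ltn_expl (mdeg b + d) (prime_gt1 pp).
split=> //.
- by apply: leq_ltn_trans lt; apply: leq_addr.
- by apply: leq_trans (ltnW lt); apply: leq_addl.
- by apply: leq_ltn_trans lt.
Qed.

Lemma dvdA_int p m : dvdA p (m%:R : int) -> (p %| m)%N.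
Proof.
move=> [y]; rewrite !natz => E.
have : (p%:Z %| m%:Z)%Z by apply/dvdzP; exists y; rewrite mulrC.
by [].
Qed.

(** For each relevant prime a multiple by an integer prime to it is found: from the pair of
    multidegree [b] if it belongs to the reduced collection, otherwise from an orbit sum with more
    than [d] nonzero slots, which projects to zero. *)
Lemma prim_in_gens (b : 'X_{1..r}) : (0 < d)%N -> b != 0%MM ->
  (forall g : {mpoly A[r * d]}, TS g -> (msize g <= mdeg b)%N -> gen_alg gens g) ->
  gen_alg gens (gam A d (mgcd b) (prim b)).
Proof.
move=> d0 nb low.
have [[k [a [Ca aE]]]|->] := inC_or_gam0 nb; last exact: ga_zero.
have [kd na _] := Ca; have /andP[k0 kd'] := kd.
have bdeg : mdeg b = (k * mdeg a)%N by rewrite -aE mdegMn mulnC.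
suff H p : prime p -> (inCt A d c k a -> ~~ (p %| mgcd a)%N) ->
    (~ inCt A d c k a -> (exists J, (dig p d J < \sum_i dig p (b i) J)%N /\
      forall l, (J < l)%N -> \sum_i dig p (b i) l = dig p d l)) ->
    exists e : int, ~ dvdA p e /\ gen_alg gens (e%:~R *: gam A d (mgcd b) (prim b)).
  (* A prime beyond [d + mdeg b] supplies the nonzero integer that starts the descent, whether or
     not it is invertible in [A]. *)
  have [p0 lp0 pp0] := prime_above (d + mdeg b).
  have [||e0 [ne0 Je0]] := H p0 pp0.
  - move=> _; rewrite gtnNdvd ?mgcd_gt0 //; apply: leq_ltn_trans lp0.
    apply: leq_trans (leq_addl _ _); rewrite bdeg.
    have [i ai] : exists i, a i != 0%N.
      apply/existsP; apply: contraT; rewrite negb_exists => /forallP E.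
      by case/eqP: na; apply/mnmP => i; rewrite mnm0E; apply/eqP; have := E i; rewrite negbK.
    apply: leq_trans (dvdn_leq _ (mgcd_dvd a i)) _; first by rewrite lt0n.
    apply: leq_trans (leq_pmull _ k0).
    by rewrite mdegE (bigD1 i) //= leq_addr.
  - move=> nCt; exists 0%N; apply: big_prime_digits.
    + exact: prime_gt1.
    + by apply: leq_ltn_trans lp0; apply: leq_addr.
    + move=> i; apply: leq_ltn_trans lp0; apply: leq_trans (leq_addl _ _).
      by rewrite mdegE (bigD1 i) //= leq_addr.
    + rewrite -mdegE bdeg ltnNge; apply/negP => le; apply: nCt.
      by split=> //; left.
  apply: (ga_int_combination (c0 := e0)) => //.
    by apply/eqP => e00; apply: ne0; rewrite e00; apply: dvdA0.
  move=> p Pp; apply: H; first by case: Pp.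
    by move=> _; exact: (mgcd_inC Ca Pp).
  move=> nCt; have pp : prime p by case: Pp.
  have [J [J1 J2]] : exists J, (dig p d J < \sum_i dig p (k * a i) J)%N /\
      forall l, (J < l)%N -> \sum_i dig p (k * a i) l = dig p d l.
    apply: polygt_digits; first exact: prime_gt1.
    apply: NNPP => npg; apply: nCt; split=> //; right; exists p; split=> //.
  have bE i : (k * a i = b i)%N by rewrite -aE mulmnE mulnC.
  exists J; split; first by under eq_bigr => i _ do rewrite -bE.
  by move=> l Jl; rewrite -J2 //; apply: eq_bigr => i _; rewrite bE.
move=> pp HC HN.
have [n [K [nK bn dn n0]]] := prime_slots b pp d0.
pose j0 := Ordinal n0.
have [i0 pi0] := prim_coef_ndvd nb pp.
have [Ct|nCt] := classic (inCt A d c k a).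
  apply: (@ga_multiple A r d gens b p n i0 j0 dn (gam int n k a)) => //.
  - by exists K.
  - exact: TS_gam.
  - by move=> M; rewrite mcoeff_msupp => /mcoeff_gam_neq0 ->.
  (* The value is [a i0] times a binomial coefficient, both prime to [p]. *)
  - rewrite fnl_gam // aE eqxx mul1r => /dvdA_int.
    rewrite Euclid_dvdM // => /orP[|]; last first.
      apply/negP; apply: (bin_ndvd pp nK); rewrite prednK //.
      apply: leq_trans (ltnW bn); rewrite bdeg leq_pmulr // lt0n mdeg_eq0 //.
    have -> : a = (prim b *+ mgcd a)%MM by rewrite -aE -prim_mulmn // aE.
    by rewrite mulmnE Euclid_dvdM // (negbTE pi0) (negbTE (HC Ct)).
  - by rewrite proj_gam //; apply: ga_gen; exists k, a.
have [J [J1 J2]] := HN nCt.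
have g0 := mgcd_gt0 nb.
have bi0 : b i0 = (prim b i0 * mgcd b)%N by rewrite -{1}(primK b) mulmnE.
have pi00 : (0 < prim b i0)%N by rewrite lt0n; apply: contraNneq pi0 => ->; rewrite dvdn0.
have lg : logn p (b i0) = logn p (mgcd b).
  by rewrite bi0 lognM // logn_coprime // prime_coprime.
have [s [ss ws dnz nt]] : exists s, [/\ size s = n, wt s = b, (d < nz s)%N
    & ~~ (p %| tau i0 j0 s)%N].
  apply: (@tau_exists r n p K i0 j0 pp nK b d J nb (ltnW bn) _ _ J1 J2).
    by rewrite bi0 muln_gt0 pi00.
  move=> i; rewrite lg; apply: dvdn_trans (mgcd_dvd b i).
  exact: pfactor_dvdnn.
apply: (@ga_multiple A r d gens b p n i0 j0 dn (orb int n s)) => //.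
- by exists K.
- exact: TS_orb.
- by move=> M /(msupp_orb ss) /perm_wt ->.
- by rewrite fnl_orb // ws eqxx mul1r => /dvdA_int; apply/negP.
- by rewrite proj_orb_nz //; apply: ga_zero.
Qed.

(** Induction on the degree: an orbit sum is a multiple of the generator of its multidegree, up to
    the algebra generated in lower degree. *)
Lemma TS_gens f : (0 < d)%N -> TS f -> gen_alg gens f.
Proof.
move=> d0; have [m] := ubnP (msize f); elim: m f => // m IH f lt Tf.
apply: TS_ind Tf _ _ _.
- exact: ga_zero.
- by move=> g h; apply: ga_add.
move=> M Mf; apply: ga_scale.
have Mm : (mdeg M < m)%N by apply: leq_trans (msize_mdeg_lt Mf) _.
have [w0|nw] := eqVneq (wt (slots M)) 0%MM.
  have : (msize (orb A d (slots M)) <= 1)%N.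
    apply/msize_leP => M' /(msupp_orb (size_slots M)) /perm_wt E.
    by rewrite mdeg_slots E w0 mdeg0.
  by move/msize1_polyC => ->; apply: ga_const.
have low g : TS g -> (msize g <= mdeg (wt (slots M)))%N -> gen_alg gens g.
  by move=> Tg le; apply: IH => //; apply: leq_ltn_trans le _; rewrite -mdeg_slots.
have [e He] : decomp (wt (slots M)) (orb A d (slots M)).
  apply: decomp_TS => //; first by apply: TS_orb; rewrite size_slots.
  by move=> M' /(msupp_orb (size_slots M)) /perm_wt.
rewrite -[orb _ _ _](subrK (e *: gam A d (mgcd (wt (slots M))) (prim (wt (slots M))))).
apply: ga_add; last by apply: ga_scale; apply: prim_in_gens.
by apply: ga_trans He => g [Tg sg]; apply: low.
Qed.

Lemma gens_TS f : gen_alg gens f -> TS f.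
Proof.
elim=> [g [k [a [[[_ na _] _] ->]]]|e|g h _ Tg _ Th|g h _ Tg _ Th].
- exact: TS_gam.
- exact: TS_C.
- exact: TS_D.
- exact: TS_M.
Qed.

End Generators.

(** * Minimality *)

Lemma prod_of_P_coprime (A : comNzRingType) l m :
  prod_of_P A l -> invertible (m%:R : A) -> coprime l m.
Proof.
move=> [s [sP ->]] im; rewrite big_seq; apply: (big_ind (fun x => coprime x m)).
- exact: coprime1n.
- by move=> x y cx cy; rewrite coprimeMl cx.
move=> p /sP [pp ninv]; rewrite prime_coprime //; apply/negP => pm.
exact: ninv (invertible_dvd pm im).
Qed.

(** The gcd of the multidegree is [k * mgcd a = k' * mgcd a']. In the first collection [k] is
    coprime to [mgcd a'], hence divides [k'], and conversely; in the second [k] is the gcd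
    itself. *)
Lemma inC_inj (A : comNzRingType) r d c k (a : 'X_{1..r}) k' a' :
  inC A d c k a -> inC A d c k' a' -> (a' *+ k')%MM = (a *+ k)%MM ->
  k' = k /\ a' = a.
Proof.
move=> [/andP[k0 _] na H] [/andP[k0' _] na' H'] E.
have gE : (k' * mgcd a' = k * mgcd a)%N by rewrite -!mgcd_mulmn E.
suff kk : k' = k by split=> //; apply: (mulmnI k0); rewrite -E kk.
case: c H H' => [[ia Pk] [ia' Pk']|a1 a1']; last first.
  by move: gE; rewrite a1 a1' !muln1.
apply/eqP; rewrite eqn_dvd; apply/andP; split.
  by rewrite -(Gauss_dvdl _ (prod_of_P_coprime Pk' ia)) -gE dvdn_mulr.
by rewrite -(Gauss_dvdl _ (prod_of_P_coprime Pk ia')) gE dvdn_mulr.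
Qed.

Lemma nz_le_mdeg r (s : seq 'X_{1..r}) : (nz s <= mdeg (wt s))%N.
Proof.
rewrite mdeg_wt /nz -sum1_count big_mkcond /=; apply: leq_sum => v _.
by case: ifP => // nv; rewrite lt0n mdeg_eq0.
Qed.

(** Were [m] prime to [p], a Bezout relation combined with [m = p * y] in [A] would give an inverse
    of [p]. *)
Lemma inP_dvdA (A : comNzRingType) p m :
  inP A p -> dvdA p (m%:R : A) -> (p %| m)%N.
Proof.
move=> [pp ninv] [y mE]; apply: contraT => pm; case: ninv.
have [u v E _] := egcdnP m (prime_gt0 pp).
have cop : gcdn p m = 1%N by apply/eqP; rewrite -/(coprime p m) prime_coprime.
exists (u%:R - v%:R * y); rewrite mulrBr mulrCA -mE -!natrM [(p * u)%N]mulnC E cop.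
by rewrite natrD addrC addKr.
Qed.

Section Minimality.
Variables (A : comNzRingType) (r d : nat) (c : bool) (S : nat -> 'X_{1..r} -> Prop).
Hypothesis SC : forall k a, S k a -> inCt A d c k a.
Hypothesis d0 : (0 < d)%N.

Definition gens_in n : {mpoly A[r * n]} -> Prop :=
  fun g => exists k a, S k a /\ g = gam A n k a.

Lemma gens_lift n (dn : (d <= n)%N) f : gen_alg (@gens_in d) f ->
  exists2 h, gen_alg (@gens_in n) h & proj (idfun : {rmorphism A -> A}) d h = f.
Proof.
elim=> [g [k [a [Ska ->]]]|e|g h _ [g' Gg <-] _ [h' Gh <-]|g h _ [g' Gg <-] _ [h' Gh <-]].
- exists (gam A n k a); first by apply: ga_gen; exists k, a.
  by apply: proj_gam => //; case: (SC Ska) => -[].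
- by exists e%:MP; [apply: ga_const|rewrite projC].
- by exists (g' + h'); [apply: ga_add|rewrite projD].
- by exists (g' * h'); [apply: ga_mul|rewrite projM].
Qed.

(** A relation in [d] slots lifts to [p ^ K] slots up to orbit sums with more than [d] nonzero
    slots. Modulo [p] the functional vanishes on those and on the algebra generated by the pairs of
    other multidegrees, but not on [gam A n k a]. *)
Lemma minimal_mod_p k a p : inC A d c k a -> ~ S k a -> inP A p ->
  ((k * mdeg a <= d)%N \/ polyle (Qpv p k a) (Qp p d)) ->
  ~ gen_alg (@gens_in d) (gam A d k a).
Proof.
move=> Ca nS Pp small Gf; have [/andP[k0 kd] na _] := Ca; have [pp _] := Pp.
set b := (a *+ k)%MM; have bdeg : mdeg b = (k * mdeg a)%N by rewrite mdegMn mulnC.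
have [i0 ai0] : exists i0, ~~ (p %| a i0)%N.
  apply/existsP; apply: contraT; rewrite negb_exists => /forallP H.
  have := mgcd_inC Ca Pp; rewrite dvdn_mgcd // => i.
  by have := H i; rewrite negbK.
have ai00 : (0 < a i0)%N by rewrite lt0n; apply: contraNneq ai0 => ->; rewrite dvdn0.
have [n [K [nK bn dn n0]]] := prime_slots b pp d0.
pose j0 := Ordinal n0.
(* If [k * mdeg a <= d], the degree is too small for more than [d] nonzero slots; otherwise [tau_qv]
   would contradict the digit condition. *)
have tau_dvd s : size s = n -> wt s = b -> (d < nz s)%N -> (p %| tau i0 j0 s)%N.
  move=> ss ws ds; apply: contraT => nd; case: small => [le|].
    by move: ds; rewrite ltnNge (leq_trans (nz_le_mdeg s)) // ws bdeg.
  case; apply/polygt_qvP; exists p => m pm.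
  have := tau_qv pp nK ss _ ds nd pm; rewrite ws mulmnE muln_gt0 ai00 k0 => /(_ isT).
  by move/leq_trans; apply; apply: leq_sum => i _; rewrite mulmnE mulnC.
have [h Gh hE] := gens_lift dn Gf.
have [Th dh] : TS h /\ dvdA p (fnl i0 j0 b h).
  apply: (fnl_gen pp nK bn _ Gh) => g [k' [a' [Ska' ->]]].
  have [Ca' _] := SC Ska'; have [/andP[k0' _] na' _] := Ca'.
  split; first exact: TS_gam.
  rewrite fnl_gam //; case: eqP => [E|_]; last by rewrite mul0r; apply: dvdA0.
  by have [ek ea] := inC_inj Ca Ca' E; case: nS; rewrite -ek -ea.
set g := gam A n k a; have Tg : TS g by apply: TS_gam.
have dhg : dvdA p (fnl i0 j0 b (h - g)).
  have Thg : TS (h - g) by apply: TS_B.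
  have phg : proj (idfun : {rmorphism A -> A}) d (h - g) = 0.
    by rewrite projB hE proj_gam // subrr.
  apply: (TS_ind (P := fun f => dvdA p (fnl i0 j0 b f)) Thg).
  - by rewrite /fnl diagD0 mcoeff0; apply: dvdA0.
  - by move=> f1 f2 df1 df2; rewrite fnlD; apply: dvdAD.
  move=> M Mh; rewrite fnlZ; apply: dvdAM.
  rewrite fnl_orb ?size_slots //; case: eqP => [wb|_]; last first.
    by rewrite mul0r; apply: dvdA0.
  rewrite mul1r; apply/dvdA_nat/tau_dvd => //; first by rewrite size_slots.
  by apply: (proj_eq0_nz dn _ Thg phg Mh); move=> x y.
have : dvdA p (fnl i0 j0 b g).
  have -> : g = h + (-1) *: (h - g) by rewrite scaleN1r opprB addrC subrK.
  by rewrite fnlD fnlZ; apply/dvdAD/dvdAM.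
rewrite fnl_gam // eqxx mul1r => /(inP_dvdA Pp).
rewrite Euclid_dvdM // (negbTE ai0) /=; apply/negP.
apply: (bin_ndvd pp nK); rewrite prednK //.
by apply: leq_trans (ltnW bn); rewrite bdeg leq_pmulr // lt0n mdeg_eq0.
Qed.

End Minimality.

(** * The case in which every positive integer is invertible *)

Section PolynomialsOverQ.
Variable A : comNzRingType.
Hypothesis inv : forall n, (0 < n)%N -> invertible (n%:R : A).

Lemma inv_nat_cancel n (x : A) : (0 < n)%N -> x * n%:R = 0 -> x = 0.
Proof. by move=> /inv[y ny] xn; rewrite -[x]mulr1 -ny mulrA xn mul0r. Qed.

(** Even if [A] has zero divisors, differences of distinct roots are invertible integers up to sign,
    so linear factors split off one after another. *)
Lemma poly_nat_roots m a (P : {poly A}) : (size P <= m.+1)%N ->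
  (forall i, (i <= m)%N -> P.[(a + i)%:R] = 0) -> P = 0.
Proof.
elim: m a P => [|m IH] a P sP H.
  have := H 0%N isT; rewrite (size1_polyC sP) hornerC => ->; exact: polyC0.
have /factor_theorem[Q QE] : root P a%:R.
  by have := H 0%N isT; rewrite addn0 => /eqP.
suff Q0 : Q = 0 by rewrite QE Q0 mul0r.
apply: (IH a.+1).
  have [->|Q0] := eqVneq Q 0; first by rewrite size_poly0.
  by move: sP; rewrite QE size_Mmonic ?monicXsubC // size_XsubC addn2.
move=> i im; apply: (@inv_nat_cancel i.+1) => //.
have := H i.+1 im; rewrite QE hornerM hornerXsubC.
by rewrite addnS -addSn [(a.+1 + i)%N]addSnnS natrD addrAC subrr add0r.
Qed.

Definition falling k : {poly A} := \prod_(j < k) ('X - j%:R%:P).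

Lemma size_falling k : size (falling k) = k.+1.
Proof. by rewrite /falling size_prod_XsubC /index_enum -enumT size_enum_ord. Qed.

Lemma horner_falling k i : (falling k).[i%:R] = (k`! * 'C(i, k))%:R.
Proof.
rewrite mulnC bin_ffact; elim: k => [|k IH].
  by rewrite /falling big_ord0 hornerC ffactn0.
rewrite /falling big_ord_recr /= hornerM -/(falling k) IH hornerXsubC ffactnSr natrM.
have [ki|ik] := leqP k i; first by rewrite natrB.
by rewrite ffact_small // !mul0r.
Qed.

Lemma falling_coef0 k : (0 < k)%N -> (falling k)`_0 = 0.
Proof. by move=> k0; rewrite -horner_coef0 (horner_falling k 0) bin0n eqn0Ngt k0 muln0. Qed.

(** Up to sign the coefficient is the factorial of [k.-1]. *)
Lemma falling_coef1 k : (0 < k)%N -> invertible (falling k)`_1.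
Proof.
case: k => // k _; rewrite /falling big_ord_recl /= subr0 coefXM /= -horner_coef0.
rewrite horner_prod; apply: big_ind => [|x y|j _].
- by exists 1; rewrite mulr1.
- exact: invertibleM.
rewrite hornerXsubC sub0r; have [y jy] := inv (ltn0Sn j).
by exists (- y); rewrite mulrNN /bump /= add1n.
Qed.

End PolynomialsOverQ.

Section FirstSlots.
Variables (A : comNzRingType) (r d : nat).
Implicit Types (f g : {mpoly A[r * d]}).

Definition first_slots i f : {mpoly A[r]} :=
  f \mPo [tuple if ((pair_of k).2 < i)%N then 'X_(pair_of k).1 else 0 | k < r * d].

(** Only the sets contained in the first [i] slots survive the substitution. *)
Lemma first_slots_gam i k v : v != 0%MM -> (i <= d)%N ->
  first_slots i (gam A d k v) = 'C(i, k)%:R *: 'X_[(v *+ k)%MM].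
Proof.
move=> nv id; rewrite /first_slots /gam raddf_sum /=.
pose B : {set 'I_d} := [set j : 'I_d | (j < i)%N].
have cB : #|B| = i.
  rewrite cardsE -sum1_card -(big_ord_widen d (fun _ => 1%N) id) sum_nat_const.
  by rewrite card_ord muln1.
have slotE j : \prod_(l < r) ('X_(var_idx l j) ^+ v l \mPo
    [tuple if ((pair_of k).2 < i)%N then 'X_(pair_of k).1 else 0 | k < r * d])
    = (if j \in B then 'X_[v] else 0) :> {mpoly A[r]}.
  under eq_bigr => l _ do
    rewrite rmorphXn /= comp_mpolyXU -tnth_nth tnth_mktuple pair_of_var_idx /=.
  rewrite inE; case: ifP => _; first by rewrite mpolyXE_id.
  have [l vl] : exists l, v l != 0%N.
    apply/existsP; apply: contraR nv; rewrite negb_exists => /forallP H.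
    by apply/eqP/mnmP => l; rewrite mnm0E; apply/eqP; have := H l; rewrite negbK.
  by rewrite (bigD1 l) //= expr0n (negbTE vl) mul0r.
rewrite (bigID (fun S : {set 'I_d} => S \subset B)) /= [X in _ + X]big1 ?addr0; last first.
  move=> S /andP[_ /subsetPn[j jS jB]]; rewrite rmorph_prod /= (bigD1 j) //=.
  by rewrite rmorph_prod /= slotE (negbTE jB) mul0r.
rewrite (eq_bigr (fun _ => 'X_[(v *+ k)%MM])); last first.
  move=> S /andP[/eqP Sk /subsetP SB]; rewrite rmorph_prod /=.
  rewrite (eq_bigr (fun _ => 'X_[v])); last first.
    by move=> j jS; rewrite rmorph_prod /= slotE (SB _ jS).
  by rewrite prodr_const Sk mpolyXn.
rewrite sumr_const scaler_nat; congr (_ *+ _).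
rewrite -cB -cards_draws -[RHS]sum1_card -[LHS]sum1_card.
by apply: eq_bigl => S; rewrite inE andbC.
Qed.

End FirstSlots.

Section MinimalityOverQ.
Variables (A : comNzRingType) (r d : nat) (c : bool) (S : nat -> 'X_{1..r} -> Prop).
Hypothesis SC : forall k a, S k a -> inCt A d c k a.
Hypothesis inv : forall n, (0 < n)%N -> invertible (n%:R : A).

(* The value of an element on the first [i] slots is a polynomial in [i], whose
   linear coefficient is a derivation at [i = 0]. *)
Lemma first_slots_poly b f : b != 0%MM -> 
  (forall k a, S k a -> (a *+ k)%MM != b) -> gen_alg (gens_in (A := A) (n := d) S) f ->
  exists P : 'X_{1..r} -> {poly A}, forall b',
    [/\ (size (P b') <= (mdeg b').+1)%N,
        forall i, (i <= d)%N -> (first_slots i f)@_b' = (P b').[i%:R],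
        b' != 0%MM -> (P b')`_0 = 0 & b' = b -> (P b')`_1 = 0].
Proof.
move=> nb Sb; elim=> [g [k [a [Ska ->]]]|e|g h _ [P HP] _ [Q HQ]|g h _ [P HP] _ [Q HQ]].
- have [[/andP[k0 _] na _] _] := SC Ska.
  have [y yk] := inv (fact_gt0 k).
  exists (fun b' => if (a *+ k == b')%MM then y *: falling A k else 0) => b'.
  split.
  + case: eqP => [<-|_]; last by rewrite size_poly0.
    apply: leq_trans (size_scale_leq _ _) _.
    by rewrite size_falling ltnS mdegMn leq_pmull // lt0n mdeg_eq0.
  + move=> i id; rewrite first_slots_gam // mcoeffZ mcoeffX.
    case: eqP => _; last by rewrite mulr0 horner0.
    by rewrite hornerZ horner_falling natrM mulrA [y * _]mulrC yk mul1r mulr1.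
  + move=> _; case: eqP => _; last by rewrite coef0.
    by rewrite coefZ falling_coef0 // mulr0.
  + by move=> ->; rewrite (negbTE (Sb _ _ Ska)) coef0.
- exists (fun b' => if b' == 0%MM then e%:P else 0) => b'; split.
  + by case: eqP => _; rewrite ?size_poly0 // (leq_trans (size_polyC_leq1 _)).
  + move=> i _; rewrite /first_slots comp_mpolyC mcoeffC.
    by case: eqP => _; rewrite ?hornerC ?horner0 ?mulr1 ?mulr0.
  + by move/negbTE ->; rewrite coef0.
  + by move=> ->; rewrite (negbTE nb) coef0.
- exists (fun b' => P b' + Q b') => b'.
  have [sP hP P0 P1] := HP b'; have [sQ hQ Q0 Q1] := HQ b'; split.
  + by apply: leq_trans (size_polyD _ _) _; rewrite geq_max sP.
  + by move=> i id; rewrite /first_slots rmorphD mcoeffD /= hornerD -hP // -hQ.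
  + by move=> nb'; rewrite coefD P0 // Q0 // addr0.
  + by move=> eb; rewrite coefD P1 // Q1 // addr0.
exists (fun b' => \sum_(k : 'X_{1..r < (mdeg b').+1, (mdeg b').+1} | b' == (k.1 + k.2)%MM)
   P k.1 * Q k.2) => b'; split.
- apply: leq_trans (size_sum _ _ _) _; apply/bigmax_leqP => -[[k1 ?] [k2 ?]] /= /eqP bE.
  have [sP _ _ _] := HP k1; have [sQ _ _ _] := HQ k2.
  apply: leq_trans (size_polyMleq _ _) _; rewrite bE mdegD.
  by have := leq_add sP sQ; rewrite addSn addnS; case: (_ + _)%N.
- move=> i id; rewrite /first_slots rmorphM mcoeffM horner_sum; apply: eq_bigr => k _.
  have [_ hP _ _] := HP k.1; have [_ hQ _ _] := HQ k.2.
  by rewrite hornerM -hP // -hQ.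
- move=> nb'; rewrite coef_sum big1 // => -[[k1 ?] [k2 ?]] /= /eqP bE.
  have [_ _ P0 _] := HP k1; have [_ _ Q0 _] := HQ k2.
  rewrite coef0M; have [k10|/P0 ->] := eqVneq k1 0%MM; last by rewrite mul0r.
  by rewrite Q0 ?mulr0 //; move: nb'; rewrite bE k10 add0m.
move=> b'b; rewrite coef_sum big1 // => -[[k1 ?] [k2 ?]] /= /eqP bE.
have [_ _ P0 P1] := HP k1; have [_ _ Q0 Q1] := HQ k2.
(* Each term pairs a constant with a linear coefficient. The constant one survives only in
   multidegree zero, and then the linear one belongs to multidegree [b] and vanishes. *)
rewrite coefM big_ord_recl big_ord1 /=.
have [k10|nk1] := eqVneq k1 0%MM.
  have k2b : k2 = b by rewrite -b'b bE k10 add0m.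
  by rewrite subn0 Q1 // Q0 ?k2b // !mulr0 addr0.
rewrite P0 // mul0r add0r; have [k20|nk2] := eqVneq k2 0%MM.
  by rewrite P1 ?mul0r // -b'b bE k20 addm0.
by rewrite Q0 // mulr0.
Qed.

(** A relation would give a polynomial of degree at most [k * mdeg a] that agrees with the binomial
    coefficient at [0, ..., k * mdeg a], all at most [d]. The two then coincide, but only one has
    zero linear coefficient. *)
Lemma minimal_over_Q k a : inC A d c k a -> ~ S k a -> (k * mdeg a <= d)%N ->
  ~ gen_alg (gens_in (A := A) (n := d) S) (gam A d k a).
Proof.
move=> Ca nS le Gf; have [/andP[k0 kd] na _] := Ca.
have nb : (a *+ k)%MM != 0%MM by rewrite mulmn_eq0 negb_or na -lt0n.
have [k' a' Ska'|P HP] := first_slots_poly nb _ Gf.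
  apply/eqP => E; have [Ca' _] := SC Ska'.
  by have [ek ea] := inC_inj Ca Ca' E; case: nS; rewrite -ek -ea.
have [sP hP _ P1] := HP (a *+ k)%MM.
have E : k`!%:R *: P (a *+ k)%MM - falling A k = 0.
  apply: (@poly_nat_roots _ inv (k * mdeg a) 0).
    apply: leq_trans (size_polyD _ _) _; rewrite geq_max size_polyN size_falling.
    rewrite ltnS leq_pmulr ?lt0n ?mdeg_eq0 // andbT.
    by apply: leq_trans (size_scale_leq _ _) _; rewrite mulnC -mdegMn.
  move=> i im; rewrite add0n hornerD hornerN hornerZ -hP ?(leq_trans im) //.
  rewrite first_slots_gam ?(leq_trans im) // mcoeffZ mcoeffX eqxx mulr1.
  by rewrite horner_falling natrM subrr.
have [y] := falling_coef1 inv k0.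
have := congr1 (fun q : {poly A} => q`_1) E.
rewrite coefB coefZ P1 // mulr0 sub0r coef0 => /eqP; rewrite oppr_eq0 => /eqP ->.
by rewrite mul0r => /esym/eqP; rewrite oner_eq0.
Qed.

End MinimalityOverQ.

Lemma no_P_invertible (A : comNzRingType) :
  (forall p, ~ inP A p) -> forall n, (0 < n)%N -> invertible (n%:R : A).
Proof.
move=> noP n /(P_part A)[k [m [-> [s [sP ->]] im]]].
case: s sP => [_|p s sP]; first by rewrite big_nil mul1n.
by case: (noP p); apply: sP; rewrite mem_head.
Qed.

Theorem theorem7p19 (A : comNzRingType) (r d : nat) (hr : (1 <= r)%N) (hd : (1 <= d)%N)
  (c : bool) :
  (forall p : {mpoly A[r * d]},
     gen_alg (fun g => exists k a, inCt A d c k a /\ g = gam A d k a) p <-> TS p) /\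
  (forall S : nat -> 'X_{1..r} -> Prop,
     (forall k a, S k a -> inCt A d c k a) ->
     (forall p : {mpoly A[r * d]}, TS p ->
        gen_alg (fun g => exists k a, S k a /\ g = gam A d k a) p) ->
     forall k a, inCt A d c k a -> S k a).
Proof.
split=> [p|S SC genS k a [Ca small]].
  by split; [apply: gens_TS|apply: TS_gens].
apply: NNPP => nS; have [_ na _] := Ca.
have /genS Gf : TS (gam A d k a) by apply: TS_gam.
(* Without noninvertible primes only the degree condition can hold, and every positive integer is
   invertible. Otherwise any such prime serves for the degree condition, and the given one for the
   digit condition. *)
have [[p Pp]|noP] := classic (exists p, inP A p); last first.
  case: small => [le|[p [Pp _]]]; last by case: noP; exists p.
  apply: (minimal_over_Q SC _ Ca nS le Gf); apply: no_P_invertible => p Pp.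
  by case: noP; exists p.
case: small => [le|[q [Pq le]]].
  by apply: (minimal_mod_p SC hd Ca nS Pp _ Gf); left.
by apply: (minimal_mod_p SC hd Ca nS Pq _ Gf); right.
Qed.
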